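(* Let $\mathbf{G}$ be one of the ind-groups $\mathrm{GL}(\infty)$, $\mathrm{O}(\infty)$, $\mathrm{Sp}(\infty)$, let $\ell\ge 4$, and let $\mathbf{P}_1,\dots,\mathbf{P}_\ell\subsetneq\mathbf{G}$ be splitting parabolic subgroups. Then $\mathbf{X}=\mathbf{G}/\mathbf{P}_1\times\cdots\times\mathbf{G}/\mathbf{P}_\ell$, with the diagonal action of $\mathbf{G}$, has an infinite number of $\mathbf{G}$-orbits.
   Context: The base field is $\mathbb{C}$. $V$ is a vector space of countably infinite dimension. Three types: (A) no additional structure on $V$; (BD) $V$ has a nondegenerate symmetric bilinear form $\omega$; (C) $V$ has a symplectic (nondegenerate alternating) form $\omega$. (BCD) means (BD) or (C). A countable-dimensional subspace $V_*\subset V^*=\mathrm{Hom}(V,\mathbb{C})$ with nondegenerate pairing $V_*\times V\to\mathbb{C}$ is fixed (arbitrary in type (A); $V_*=\{\omega(v,\cdot):v\in V\}$ in type (BCD)). $\mathrm{GL}(\infty)$ is the group of all $g\in\mathrm{GL}(V)$ such that $g(V_* )=V_*$ and $g$ fixes pointwise some finite-codimensional subspaces of $V$ and of $V_*$; $\mathrm{O}(\infty)$ (type (BD)) and $\mathrm{Sp}(\infty)$ (type (C)) are the subgroups of $g\in \mathrm{GL}(\infty)$ preserving $\omega$. A basis $E$ of $V$ is admissible if: in type (A), the dual family $\{\phi_e:e\in E\}$ ($\phi_e(e')=\delta_{e,e'}$) spans $V_*$; in type (BCD), $E$ has an involution $i_E:E\to E$ with at most one fixed point such that $\omega(e,e')\neq0$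 iff $e'=i_E(e)$. For an admissible basis $E$, let $\mathbf{H}(E)\subset\mathbf{G}$ be the subgroup of elements diagonal in $E$ (a splitting Cartan subgroup). Fix an exhausting increasing filtration $E=\bigcup_{n\ge1}E_n$ by finite subsets ($i_E$-stable in type (BCD)) and put $\mathbf{G}(E_n)=\mathbf{G}\cap\mathrm{GL}(\langle E_n\rangle)$, where $\mathrm{GL}(\langle E_n\rangle)$ acts on $V$ trivially on $E\setminus E_n$; $\langle\cdot\rangle$ is linear span. A splitting parabolic subgroup is a subgroup $\mathbf{P}\subset\mathbf{G}$ containing $\mathbf{H}(E)$ for some admissible $E$ and such that $\mathbf{P}\cap\mathbf{G}(E_n)$ is a parabolic subgroup of $\mathbf{G}(E_n)$ for all $n$. Known description (Dimitrov–Penkov), which may be taken as the definition: these are exactly the stabilizers $\{g\in\mathbf{G}:g\mathcal{F}=\mathcal{F}\}$ of generalized flags $\mathcal{F}$ compatible with some admissible basis $E$ (in particular parabolic subgroups of $\mathrm{O}_m$ are understood as stabilizers of isotropic flags). Here a generalized flag is a set $\mathcal{F}$ of subspaces of $V$, totally ordered by inclusion, such that every $F\in\mathcal{F}$ has an immediate predecessor or immediate successor in $\mathcal{F}$, for every nonzero $v\in V$ there are consecutive $F'\subset F''$ in $\mathcal{F}$ with $v\in F''\setminus F'$, and, in type (BCD), $F\mapsto F^\perp$ is an involution of $\mathcal{F}$; it is $E$-compatible if each $F\in\mathcal{F}$ is spanned by a subset of $E$. *)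

(* Defs.v *)
From HB Require Import structures.
From mathcomp Require Import all_boot all_order all_algebra.
From mathcomp Require Import complex.
From mathcomp Require Import all_classical all_reals.

Set Implicit Arguments.
Unset Strict Implicit.
Unset Printing Implicit Defensive.

Import GRing.Theory.
Local Open Scope ring_scope.
Local Open Scope classical_set_scope.

Section LinearAlgebra.
Context {K : fieldType} {U : lmodType K}.

Definition is_subspace (A : set U) : Prop :=
  A 0 /\ forall (a : K) (u v : U), A u -> A v -> A (a *: u + v).

Definition lspan (A : set U) : set U :=
  [set v | exists (s : seq U) (a : U -> K),
     [set` s] `<=` A /\ v = \sum_(x <- s) a x *: x].

Definition lin_indep (A : set U) : Prop :=
  forall (s : seq U) (a : U -> K), uniq s -> [set` s] `<=` A ->
    \sum_(x <- s) a x *: x = 0 -> forall x, x \in s -> a x = 0.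

Definition is_basis (W E : set U) : Prop := lin_indep E /\ lspan E = W.

Definition finite_codim (W A : set U) : Prop :=
  exists s : seq U, [set` s] `<=` W /\
    forall w, W w -> exists u v, [/\ A u, lspan [set` s] v & w = u + v].

End LinearAlgebra.

(* Elements of the algebraic dual of V are represented as maps V -> K^o: the
   regular module K^o makes V -> K^o an lmodType under pointwise operations. *)
Section IndGroups.
Context {K : fieldType} {V : lmodType K}.

(* TypeA carries V_*; in the other two types V_* is determined by the form. *)
Variant ind_data : Type :=
  | TypeA of set (V -> K^o)
  | TypeBD of {biscalar V}
  | TypeC of {biscalar V}.

Definition form_of (S : ind_data) : option {biscalar V} :=
  match S with
  | TypeA _ => None
  | TypeBD w | TypeC w => Some w
  end.

Definition predual (S : ind_data) : set (V -> K^o) :=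
  match S with
  | TypeA W => W
  | TypeBD w | TypeC w => [set (fun u => w v u) | v in [set: V]]
  end.

Definition nondegenerate_form (w : {biscalar V}) : Prop :=
  forall u, (forall v, w u v = 0) -> u = 0.

(* In TypeA, nondegeneracy on the V_* side holds automatically, the elements of
   V_* being functions on V. *)
Definition valid_data (S : ind_data) : Prop :=
  match S with
  | TypeA W =>
      [/\ is_subspace W,
          forall phi, W phi -> linear phi,
          exists B, is_basis W B /\ countable B
        & forall v, (forall phi, W phi -> phi v = 0) -> v = 0]
  | TypeBD w => (forall u v, w u v = w v u) /\ nondegenerate_form w
  | TypeC w => (forall v, w v v = 0) /\ nondegenerate_form w
  end.

(* The contragredient action phi |-> phi \o g^-1; used only for bijective g. *)
Definition dual_act (g : V -> V) (phi : V -> K^o) : V -> K^o :=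
  phi \o 'pinv_(fun=> 0) [set: V] g.

Definition GL_inf (S : ind_data) : set (V -> V) :=
  [set g | [/\ linear g, bijective g,
     dual_act g @` predual S = predual S,
     exists A, [/\ is_subspace A, finite_codim [set: V] A
                 & forall v, A v -> g v = v]
   & exists A, [/\ is_subspace A, A `<=` predual S,
                   finite_codim (predual S) A
                 & forall phi, A phi -> dual_act g phi = phi]]].

Definition ind_group (S : ind_data) : set (V -> V) :=
  [set g | GL_inf S g /\
     if form_of S is Some w then forall u v, w (g u) (g v) = w u v else True].

Definition dual_family (E : set V) : set (V -> K^o) :=
  [set phi | linear phi /\
     exists2 e, E e & forall e', E e' -> phi e' = (e' == e)%:R].

Definition admissible (S : ind_data) (E : set V) : Prop :=
  is_basis [set: V] E /\
  if form_of S is Some w then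
    exists iE : V -> V,
      [/\ forall e, E e -> E (iE e) /\ iE (iE e) = e,
          forall e e', E e -> E e' -> iE e = e -> iE e' = e' -> e = e'
        & forall e e', E e -> E e' -> (w e e' != 0 <-> e' = iE e)]
  else lspan (dual_family E) = predual S.

Definition perp (w : {biscalar V}) (F : set V) : set V :=
  [set v | forall u, F u -> w u v = 0].

Definition consecutive (FF : set (set V)) (F F' : set V) : Prop :=
  [/\ FF F, FF F', F `<` F'
    & forall H, FF H -> F `<=` H -> H `<=` F' -> H = F \/ H = F'].

Definition generalized_flag (S : ind_data) (FF : set (set V)) : Prop :=
  [/\ forall F, FF F -> is_subspace F,
      forall F H, FF F -> FF H -> F `<=` H \/ H `<=` F,
      forall F, FF F ->
        exists H, consecutive FF H F \/ consecutive FF F H,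
      forall v, v != 0 ->
        exists F F', consecutive FF F F' /\ (F' `\` F) v
    & if form_of S is Some w then
        forall F, FF F -> FF (perp w F) /\ perp w (perp w F) = F
      else True].

Definition compatible (E : set V) (FF : set (set V)) : Prop :=
  forall F, FF F -> exists2 A, A `<=` E & F = lspan A.

Definition flag_stabilizer (S : ind_data) (FF : set (set V)) : set (V -> V) :=
  [set g | ind_group S g /\ [set g @` F | F in FF] = FF].

(* Dimitrov-Penkov: splitting parabolic subgroups are exactly the stabilizers
   of generalized flags compatible with some admissible basis. *)
Definition splitting_parabolic (S : ind_data) (P : set (V -> V)) : Prop :=
  exists E FF, [/\ admissible S E, generalized_flag S FF, compatible E FF
                 & P = flag_stabilizer S FF].

End IndGroups.
Arguments ind_data {K} V.

Section Orbits.
Context {T : Type}.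

Definition translate (g : T -> T) (C : set (T -> T)) : set (T -> T) :=
  [set g \o c | c in C].

Definition left_cosets (G P : set (T -> T)) : set (set (T -> T)) :=
  [set translate g P | g in G].

Definition flag_product (G : set (T -> T)) (l : nat)
    (P : 'I_l -> set (T -> T)) : set ('I_l -> set (T -> T)) :=
  [set x | forall i, left_cosets G (P i) (x i)].

Definition diag_orbit (G : set (T -> T)) (l : nat)
    (x : 'I_l -> set (T -> T)) : set ('I_l -> set (T -> T)) :=
  [set (fun i => translate g (x i)) | g in G].

Definition diag_orbits (G : set (T -> T)) (l : nat)
    (P : 'I_l -> set (T -> T)) : set (set ('I_l -> set (T -> T))) :=
  [set diag_orbit G x | x in flag_product G P].

End Orbits.

(* Main.v *)
Require Import Defs.
From HB Require Import structures.
From mathcomp Require Import all_boot all_order all_algebra.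
From mathcomp Require Import complex.
From mathcomp Require Import all_classical all_reals.
From mathcomp Require Import ring.

(** Each proper parabolic subgroup [P i] is the stabilizer of a flag with a member
    [A i] that is neither [0] nor [V] and is spanned by a subset of an admissible
    basis; when there is a form, [A i] can be taken isotropic, since a member of the
    flag and its orthogonal are comparable. The elements of the group differ from
    the identity by maps of finite rank, hence cannot carry a subspace strictly
    into itself ([finite_rank_image]); as flags are totally ordered, [P i]
    stabilizes [A i]. So it is enough to find infinitely many tuples of translates
    of the [A i], no one of which is carried to another one by the group
    ([diag_orbits_infinite]), and there are three ways to do so.

    If two of the subspaces have infinite dimension, and infinite codimension when
    there is no form, two subspaces are enough: translates of them can be made to
    have intersections forming a strictly increasing chain of any finite length, and
    finite rank forbids to carry a member of the chain to another one
    ([separated_pair]).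

    Otherwise, if there is no form or the form is alternating, one of the subspaces
    has finite dimension or finite codimension. Translates of four of them are put
    in such a position that they meet a common plane in four lines, and split
    along the plane and one of its complements. The cross-ratio of the four lines
    is then an invariant ([separated_lines]). That the complementary parts, which
    are arbitrary, do not spoil this comes from choosing the smallest subspace (or
    the one of smallest codimension) and arranging that its complementary part
    is contained in that of another subspace (or contains it).

    For a symmetric form a plane has too few isotropic lines, and the lines of a conic
    in a nondegenerate three-dimensional space take their place; all but one of the
    subspaces have finite dimension, and what replaces the containment is the Gram
    matrix of vectors on the conic ([separated_conic]).

    All translations are made in one manner. A frame is a finite system of basis
    vectors with dual functionals, made of hyperbolic pairs when there is a form, and
    adapted to some [A i]. Basis vectors involving neither the given frames nor
    their functionals yield a fresh frame ([fresh_frame]), and exchanging the given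
    frame with any frame of the same span as the fresh one is an explicit element of
    the group ([place_ind_group]). *)

Set Implicit Arguments.
Unset Strict Implicit.
Unset Printing Implicit Defensive.

Import GRing.Theory.
Local Open Scope ring_scope.
Local Open Scope classical_set_scope.

(** * Linear maps, spans and linear dependence *)

Section LinearMaps.
Variables (K : fieldType) (U W : lmodType K) (f : U -> W).
Hypothesis lin_f : linear f.

Let F : {linear U -> W} := HB.pack f (GRing.isLinear.Build K U W *:%R f lin_f).

Lemma lin0 : f 0 = 0.
Proof. exact: (linear0 F). Qed.

Lemma linD x y : f (x + y) = f x + f y.
Proof. exact: (linearD F). Qed.

Lemma linN x : f (- x) = - f x.
Proof. exact: (linearN F). Qed.

Lemma linB x y : f (x - y) = f x - f y.
Proof. exact: (linearB F). Qed.

Lemma linZ a x : f (a *: x) = a *: f x.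
Proof. exact: (linearZ_LR F). Qed.

Lemma lin_sum I r (P : pred I) E :
  f (\sum_(i <- r | P i) E i) = \sum_(i <- r | P i) f (E i).
Proof. exact: (linear_sum F). Qed.

End LinearMaps.

Section Spans.
Variables (K : fieldType) (U : lmodType K).
Implicit Types (A B W : set U) (s : seq U).

Lemma subspaceD A u v : is_subspace A -> A u -> A v -> A (u + v).
Proof. by move=> [_ cA] Au Av; rewrite -[u]scale1r; apply: cA. Qed.

Lemma subspaceZ A a u : is_subspace A -> A u -> A (a *: u).
Proof. by move=> [A0 cA] Au; rewrite -[_ *: _]addr0; apply: cA. Qed.

Lemma subspaceB A u v : is_subspace A -> A u -> A v -> A (u - v).
Proof.
by move=> sA Au Av; rewrite -scaleN1r; apply: subspaceD => //; apply: subspaceZ.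
Qed.

Lemma subspace_sum A (I : Type) (r : seq I) (P : pred I) (E : I -> U) :
  is_subspace A -> (forall i, P i -> A (E i)) -> A (\sum_(i <- r | P i) E i).
Proof.
move=> sA AE; apply: (big_ind (fun x => A x)) => //; first by case: sA.
by move=> x y; apply: subspaceD.
Qed.

Lemma subspaceI A B : is_subspace A -> is_subspace B -> is_subspace (A `&` B).
Proof.
move=> [A0 cA] [B0 cB]; split; first by split.
by move=> a u v [Au Bu] [Av Bv]; split; [apply: cA | apply: cB].
Qed.

Lemma subspace_image A (U' : lmodType K) (f : U -> U') :
  linear f -> is_subspace A -> is_subspace (f @` A).
Proof.
move=> lf [A0 cA]; split; first by exists 0; rewrite // (lin0 lf).
move=> a _ _ [u Au <-] [v Av <-]; exists (a *: u + v); first exact: cA.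
by rewrite (linD lf) (linZ lf).
Qed.

Lemma lspan_sub A B : is_subspace B -> A `<=` B -> lspan A `<=` B.
Proof.
move=> sB AB _ [s [a [sA ->]]]; rewrite big_seq; apply: subspace_sum => // x xs.
by apply: subspaceZ => //; apply: AB; apply: sA.
Qed.

Lemma lspan_mem A u : A u -> lspan A u.
Proof.
move=> Au; exists [:: u], (fun=> 1); split; last by rewrite big_seq1 scale1r.
by move=> x /=; rewrite inE => /eqP->.
Qed.

Lemma sum_uniq_supset s t (a : U -> K) : uniq t -> {subset s <= t} ->
  \sum_(x <- s) a x *: x = \sum_(x <- t) (a x *+ count_mem x s) *: x.
Proof.
move=> ut; elim: s => [|y s IH] st.
  by rewrite big_nil big1 // => x _; rewrite mulr0n scale0r.
rewrite big_cons IH; last by move=> x xs; apply: st; rewrite inE xs orbT.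
have yt : y \in t by apply: st; rewrite mem_head.
under [RHS]eq_bigr do rewrite /= mulrnDr scalerDl.
rewrite big_split /=; congr (_ + _).
rewrite (bigD1_seq y) //= eqxx mulr1n big1 ?addr0 // => x.
by rewrite eq_sym => /negPf->; rewrite mulr0n scale0r.
Qed.

Lemma lspan_subspace A : is_subspace (lspan A).
Proof.
split; first by exists [::], (fun=> 0); split=> //; rewrite big_nil.
move=> c _ _ [s1 [a1 [s1A ->]]] [s2 [a2 [s2A ->]]].
pose t := undup (s1 ++ s2).
have ut : uniq t by apply: undup_uniq.
exists t, (fun x => c * (a1 x *+ count_mem x s1) + a2 x *+ count_mem x s2).
split=> [x /=|].
  by rewrite mem_undup mem_cat => /orP[] xs; [apply: s1A | apply: s2A].
rewrite (@sum_uniq_supset s1 t) //; last first.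
  by move=> x xs; rewrite mem_undup mem_cat xs.
rewrite (@sum_uniq_supset s2 t) //; last first.
  by move=> x xs; rewrite mem_undup mem_cat xs orbT.
rewrite scaler_sumr -big_split; apply: eq_bigr => x _ /=.
by rewrite scalerA -scalerDl.
Qed.

Lemma lspanS A B : A `<=` B -> lspan A `<=` lspan B.
Proof.
move=> AB; apply: lspan_sub; first exact: lspan_subspace.
by move=> x /AB; apply: lspan_mem.
Qed.

(** A homogeneous system with more unknowns than equations has a nonzero
    solution, whence more vectors than generators are dependent. *)
Lemma lspan_dependent s (v : 'I_(size s).+1 -> U) :
  (forall i, lspan [set` s] (v i)) ->
  exists c : 'I_(size s).+1 -> K,
    (exists i, c i != 0) /\ \sum_i c i *: v i = 0.
Proof.
move=> sv.
have /choice[a av] : forall i, exists a : U -> K,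
    v i = \sum_(x <- undup s) a x *: x.
  move=> i; have [r [b [rs ->]]] := sv i.
  exists (fun x => b x *+ count_mem x r); apply: sum_uniq_supset.
    exact: undup_uniq.
  by move=> x xr; rewrite mem_undup; apply: rs.
pose M : 'M[K]_((size s).+1, size (undup s)) :=
  \matrix_(i, j) a i (tnth (in_tuple (undup s)) j).
have : kermx M != 0.
  rewrite kermx_eq0; apply/negP => /eqP rM; have := rank_leq_col M.
  by rewrite rM ltnNge size_undup.
case/rowV0Pn => c /sub_kermxP cM /rV0Pn[i ci]; exists (c 0); split; first by exists i.
under eq_bigr => k _.
  rewrite av (big_nth 0) big_mkord scaler_sumr.
  under eq_bigr do rewrite scalerA.
  over.
rewrite exchange_big big1 // => j _.
rewrite -scaler_suml; have /rowP/(_ j) := cM; rewrite !mxE => e.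
rewrite [X in X *: _](_ : _ = 0) ?scale0r // -[RHS]e.
by apply: eq_bigr => k _; rewrite !mxE (tnth_nth 0).
Qed.

End Spans.

Lemma infinite_notin (T : choiceType) (E : set T) (s : seq T) :
  infinite_set E -> exists2 x, E x & x \notin s.
Proof.
move=> infE; apply: contrapT => h; apply: infE.
apply: (@sub_finite_set _ _ [set` s]); last by apply/finite_seqP; exists s.
move=> x Ex /=; apply: contrapT => /negP xs; apply: h.
by exists x.
Qed.

Lemma infinite_uniq_extend (T : choiceType) (E : set T) (avoid : seq T) n :
  infinite_set E -> exists t, [/\ size t = n, uniq t, [set` t] `<=` E
    & forall x, x \in t -> x \notin avoid].
Proof.
move=> infE; elim: n => [|n [t [st ut tE ta]]]; first by exists [::].
have [x Ex] := infinite_notin (avoid ++ t) infE.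
rewrite mem_cat negb_or => /andP[xa xt]; exists (x :: t); split=> /=.
- by rewrite st.
- by rewrite xt.
- by move=> y; rewrite /= inE => /orP[/eqP->//|]; apply: tE.
- by move=> y; rewrite inE => /orP[/eqP->//|]; apply: ta.
Qed.

(** An infinite independent family does not fit in the span of finitely many
    vectors. *)
Lemma basis_infinite (K : fieldType) (U : lmodType K) (E0 E : set U) :
  lin_indep E0 -> infinite_set E0 -> lspan E = setT -> infinite_set E.
Proof.
move=> iE0 infE0 sE /finite_seqP[s Es].
have [t [st ut tE0 _]] := infinite_uniq_extend [::] (size s).+1 infE0.
have [|c [[i ci] c0]] := @lspan_dependent _ _ s (fun i => t`_i).
  by move=> i; rewrite -Es sE.
pose a x := c (inord (index x t)).
have aE : forall j : 'I_(size s).+1, a t`_j = c j.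
  by move=> j; rewrite /a index_uniq ?st // inord_val.
have sum0 : \sum_(x <- t) a x *: x = 0.
  rewrite (big_nth 0) st big_mkord -[RHS]c0.
  by apply: eq_bigr => j _; rewrite aE.
have ti : t`_i \in t by rewrite mem_nth // st.
by have := iE0 t a ut tE0 sum0 _ ti; rewrite aE => ci0; rewrite ci0 eqxx in ci.
Qed.

(** * Finite-rank perturbations of the identity *)

Section FiniteRank.
Variables (K : fieldType) (U : lmodType K).
Implicit Types (A W X : set U) (h : U -> U).

(** Each new equation either holds on what is left of [W], or costs one more
    complementary vector on which it does not vanish. *)
Lemma finite_codim_kernel W (J : eqType) (r : seq J) (l : J -> U -> K^o) :
  is_subspace W -> (forall j, linear (l j)) ->
  finite_codim W [set w | W w /\ forall j, j \in r -> l j w = 0].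
Proof.
move=> sW lin_l; elim: r => [|i r [s [sW' cs]]].
  exists [::]; split=> // w Ww; exists w, 0; split=> //; last by rewrite addr0.
  by case: (@lspan_subspace K U [set` [::]]).
have [li0|/existsNP[a /not_implyP[[Wa ra] la]]] := pselect (forall w,
    W w /\ (forall j, j \in r -> l j w = 0) -> l i w = 0).
  exists s; split=> // w /cs[u [v [[Wu ru] sv ->]]]; exists u, v; split=> //.
  split=> // j; rewrite inE => /orP[/eqP->|]; [exact: li0 | exact: ru].
exists (a :: s); split=> [x|w /cs[u [v [[Wu ru] sv ->]]]].
  by rewrite /= inE => /orP[/eqP->|/sW'].
have sub_s : [set` s] `<=` [set` a :: s] by move=> x /= xs; rewrite inE xs orbT.
exists (u - (l i u / l i a) *: a), ((l i u / l i a) *: a + v); split.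
- split; first by apply: subspaceB => //; apply: subspaceZ.
  move=> j; rewrite (linB (lin_l j)) (linZ (lin_l j)) inE => /orP[/eqP->|jr].
    by rewrite [_ *: _]divfK ?subrr //; apply/eqP.
  by rewrite (ru j jr) (ra j jr) scaler0 subrr.
- apply: subspaceD; first exact: lspan_subspace.
    apply: subspaceZ; first exact: lspan_subspace.
    by apply: lspan_mem => /=; rewrite mem_head.
  exact: lspanS sub_s _ sv.
- by rewrite addrA subrK.
Qed.

Lemma finite_rank_of_fixing A h : linear h -> finite_codim setT A ->
  (forall v, A v -> h v = v) -> exists s : seq U, forall v, lspan [set` s] (h v - v).
Proof.
move=> lin_h [s [_ cs]] hA; exists [seq h x - x | x <- s] => v.
have [u [w [Au [r [a [rs ->]]] ->]]] := cs v I.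
rewrite (linD lin_h) hA // opprD addrACA subrr add0r (lin_sum lin_h) -sumrB.
rewrite big_seq; apply: subspace_sum => [|x xr]; first exact: lspan_subspace.
rewrite (linZ lin_h) -scalerBr; apply: subspaceZ; first exact: lspan_subspace.
by apply: lspan_mem; apply/mapP; exists x => //; apply: rs.
Qed.

(** The lowest nonzero term of the relation is the image under [h] of the
    higher ones. *)
Lemma iter_relation_image X h y n (c : nat -> K) :
  linear h -> injective h -> is_subspace X -> (forall x, X x -> X (h x)) ->
  X y -> \sum_(k < n) c k *: iter k h y = 0 -> (exists k : 'I_n, c k != 0) ->
  exists2 z, X z & h z = y.
Proof.
move=> lin_h inj_h sX hX Xy; elim: n c => [|n IH] c; first by move=> _ [[]].
rewrite big_ord_recl /= => sum0 ex.
have tail : \sum_(i < n) c (bump 0 i) *: h (iter i h y) =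
    h (\sum_(i < n) c i.+1 *: iter i h y).
  by rewrite (lin_sum lin_h); apply: eq_bigr => i _; rewrite (linZ lin_h).
rewrite tail in sum0; have [c0|c0] := eqVneq (c 0%N) 0.
  apply: (IH (fun k => c k.+1)).
    by apply: inj_h; rewrite (lin0 lin_h) -[RHS]sum0 c0 scale0r add0r.
  case: ex => [[[|k] lt_k]] /=; first by rewrite c0 eqxx.
  by move=> ck; exists (Ordinal (lt_k : (k < n)%N)).
exists ((- (c 0%N)^-1) *: \sum_(i < n) c i.+1 *: iter i h y).
  apply: subspaceZ => //; apply: subspace_sum => // i _; apply: subspaceZ => //.
  by elim: (nat_of_ord i) => //= k; apply: hX.
rewrite (linZ lin_h); apply: (scalerI c0); rewrite scalerA mulrN divff //.
by rewrite scaleN1r; apply/esym/eqP; rewrite -addr_eq0 sum0.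
Qed.

(** An injective [h] differing from the identity by a finite-rank map cannot map
    a subspace into itself strictly: for [x] in [X], the vectors
    [h^k (h x - x)] all lie in the finite-dimensional image of [h - 1], so they
    satisfy a relation, which puts [h x - x], hence [x], in [h X]. *)
Lemma finite_rank_image X h : linear h -> injective h ->
  (exists s : seq U, forall v, lspan [set` s] (h v - v)) ->
  is_subspace X -> h @` X `<=` X -> h @` X = X.
Proof.
move=> lin_h inj_h [s hs] sX hX; apply/seteqP; split=> // x Xx.
have stX z : X z -> X (h z) by move=> Xz; apply: hX; exists z.
have iterB k : iter k h (h x - x) = h (iter k h x) - iter k h x.
  elim: k => //= k ->; rewrite (linB lin_h); congr (_ - _); congr h.
have [|c [[i ci] c0]] := @lspan_dependent _ _ s (fun k => iter k h (h x - x)).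
  by move=> k; rewrite iterB.
have [|||z Xz hz] := @iter_relation_image X h (h x - x) (size s).+1
  (fun k => c (inord k)) lin_h inj_h sX stX.
- by apply: subspaceB => //; apply: stX.
- by rewrite -[RHS]c0; apply: eq_bigr => k _; rewrite inord_val.
- by exists i; rewrite inord_val.
exists (x - z); first exact: subspaceB.
by rewrite (linB lin_h) hz opprB addrC subrK.
Qed.

End FiniteRank.

(** * Preduals and forms *)

Section Preduals.
Variables (K : fieldType) (V : lmodType K).
Implicit Types (S : ind_data V) (w : {biscalar V}).

Lemma form_linr w u : linear (w u : V -> K^o).
Proof. by move=> a x y; rewrite linearPr. Qed.

Definition swap_sign S : K := if S is TypeC _ then -1 else 1.

Lemma swap_signK S : swap_sign S * swap_sign S = 1.
Proof. by case: S => *; rewrite /= ?mulr1 // mulrNN mulr1. Qed.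

Lemma form_swap S w u v : valid_data S -> form_of S = Some w ->
  w u v = swap_sign S * w v u.
Proof.
case: S => // [w'|w'] [sym _] [<-] /=; first by rewrite mul1r.
have := sym (u + v); rewrite linearDr !linearDl !sym add0r addr0.
by rewrite mulN1r addrC => /eqP; rewrite addr_eq0 => /eqP.
Qed.

Lemma predual_form S w u : form_of S = Some w -> predual S (w u : V -> K^o).
Proof. by case: S => // w' [<-] /=; exists u. Qed.

Lemma predual_linear S phi : valid_data S -> predual S phi -> linear phi.
Proof.
case: S => [W|w|w] /= vS; first by case: vS => _ lW _ _ /lW.
  by case=> v _ <-; apply: form_linr.
by case=> v _ <-; apply: form_linr.
Qed.

Lemma predual_subspace S : valid_data S -> is_subspace (predual S).
Proof.
have sub w : is_subspace [set ((fun u => w v u) : V -> K^o) | v in [set: V]].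
  split; first by exists 0 => //; apply/funext => u; rewrite linear0l.
  move=> a _ _ [x _ <-] [y _ <-]; exists (a *: x + y) => //; apply/funext => u.
  by rewrite linearPl.
by case: S => [W|w|w] /=; [case | move=> _; apply: sub | move=> _; apply: sub].
Qed.

End Preduals.

(** * Exchange of biorthogonal systems *)

Section Exchange.
Variables (K : fieldType) (V : lmodType K) (J : finType).
Implicit Types (x y : J -> V) (phi psi : J -> V -> K^o).

(** The map sending each [x a] to [y a] and fixing the common kernel of the
    functionals [phi a] dual to the [x a]. *)
Definition exchange x y phi (v : V) : V := v + \sum_a phi a v *: (y a - x a).

Definition biorthogonal x phi := forall a b, phi a (x b) = (a == b)%:R.

Definition same_projection x y phi psi :=
  forall v, \sum_a phi a v *: x a = \sum_a psi a v *: y a.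

Lemma biorthogonal_sum x phi b (c : J -> K) : linear (phi b) ->
  biorthogonal x phi -> phi b (\sum_a c a *: x a) = c b.
Proof.
move=> lphi xphi; rewrite (lin_sum lphi) (bigD1 b) //= big1 => [|a ab].
  by rewrite (linZ lphi) xphi eqxx addr0 [_ *: _]mulr1.
by rewrite (linZ lphi) xphi eq_sym (negPf ab) scaler0.
Qed.

Lemma exchange_vec x y phi a : biorthogonal x phi -> exchange x y phi (x a) = y a.
Proof.
move=> xphi; rewrite /exchange (bigD1 a) //= big1 => [|b ba].
  by rewrite xphi eqxx addr0 scale1r addrC subrK.
by rewrite xphi (negPf ba) scale0r.
Qed.

Lemma exchange_fix x y phi v : (forall a, phi a v = 0) -> exchange x y phi v = v.
Proof. by move=> v0; rewrite /exchange big1 ?addr0 // => a _; rewrite v0 scale0r. Qed.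

Lemma exchange_linear x y phi : (forall a, linear (phi a)) ->
  linear (exchange x y phi).
Proof.
move=> lphi c u v; rewrite /exchange scalerDr addrACA; congr (_ + _).
rewrite scaler_sumr -big_split; apply: eq_bigr => a _ /=.
by rewrite (linD (lphi a)) (linZ (lphi a)) scalerA -scalerDl.
Qed.

Section Inverse.
Variables (x y : J -> V) (phi psi : J -> V -> K^o).
Hypotheses (lphi : forall a, linear (phi a)) (lpsi : forall a, linear (psi a)).
Hypotheses (xphi : biorthogonal x phi) (ypsi : biorthogonal y psi).
Hypothesis xy : same_projection x y phi psi.

Lemma coord_exchange a v : psi a (exchange x y phi v) = phi a v.
Proof.
rewrite /exchange; under eq_bigr do rewrite scalerBr.
rewrite sumrB (linD (lpsi a)) (linB (lpsi a)) xy !biorthogonal_sum //.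
by rewrite addrC subrK.
Qed.

Lemma exchangeK : cancel (exchange x y phi) (exchange y x psi).
Proof.
move=> v; rewrite {1}/exchange; under eq_bigr do rewrite coord_exchange -opprB.
rewrite /exchange -addrA -big_split big1 ?addr0 // => a _ /=.
by rewrite -scalerDr subrr scaler0.
Qed.

Lemma same_projection_ker u : (forall a, phi a u = 0) -> forall a, psi a u = 0.
Proof.
move=> u0 a; rewrite -(biorthogonal_sum (b := a) (psi^~ u) (lpsi a) ypsi).
by rewrite -xy big1 ?(lin0 (lpsi a)) // => b _; rewrite u0 scale0r.
Qed.

End Inverse.
End Exchange.

Lemma dual_act_cancel (K : fieldType) (V : lmodType K) (g g' : V -> V) :
  cancel g g' -> cancel g' g -> forall phi : V -> K^o, dual_act g phi = phi \o g'.
Proof.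
move=> gK g'K phi; apply/funext => v; rewrite /dual_act /=; congr phi.
rewrite -[in LHS](g'K v) pinvKV ?inE //.
by move=> a b _ _; apply: (can_inj gK).
Qed.

Section ExchangeGroup.
Variables (K : fieldType) (V : lmodType K) (S : ind_data V).
Hypothesis vS : valid_data S.
Variables (J : finType) (x y : J -> V) (phi psi : J -> V -> K^o).
Hypotheses (Sphi : forall a, predual S (phi a)) (Spsi : forall a, predual S (psi a)).
Hypotheses (xphi : biorthogonal x phi) (ypsi : biorthogonal y psi).
Hypothesis xy : same_projection x y phi psi.

Let lphi a : linear (phi a). Proof. exact: predual_linear vS (Sphi a). Qed.
Let lpsi a : linear (psi a). Proof. exact: predual_linear vS (Spsi a). Qed.
Let yx : same_projection y x psi phi. Proof. by move=> v; rewrite xy. Qed.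
Let g := exchange x y phi.
Let g' := exchange y x psi.
Let gK : cancel g g'. Proof. exact: exchangeK. Qed.
Let g'K : cancel g' g. Proof. exact: exchangeK. Qed.

Let dual_form (x1 y1 : J -> V) (phi1 : J -> V -> K^o) (th : V -> K^o) :
  linear th -> th \o exchange x1 y1 phi1 =
    \sum_a th (y1 a - x1 a) *: phi1 a + th.
Proof.
move=> lth; apply/funext => v; rewrite /= /exchange (linD lth) (lin_sum lth) addrC.
rewrite fctE fct_sumE; congr (_ + _); apply: eq_bigr => a _.
by rewrite (linZ lth) [LHS]mulrC.
Qed.

Let predual_comp (x1 y1 : J -> V) (phi1 : J -> V -> K^o) (th : V -> K^o) :
  (forall a, predual S (phi1 a)) -> predual S th ->
  predual S (th \o exchange x1 y1 phi1).
Proof.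
move=> S1 Sth; rewrite dual_form; last exact: predual_linear Sth.
have sS := predual_subspace vS; apply: subspaceD => //.
by apply: subspace_sum => // a _; apply: subspaceZ.
Qed.

Lemma exchange_GL : GL_inf S g.
Proof.
have sS := predual_subspace vS.
split.
- exact: exchange_linear.
- by exists g'.
- apply/seteqP; split=> [_ [th Sth <-]|th Sth].
    by rewrite (dual_act_cancel gK g'K); apply: predual_comp.
  exists (th \o g); first exact: predual_comp.
  by rewrite (dual_act_cancel gK g'K); apply/funext => v /=; rewrite g'K.
- exists [set v | setT v /\ forall a, a \in index_enum J -> phi a v = 0]; split.
  + split; first by split=> // a _; rewrite (lin0 (lphi a)).
    move=> c u v [_ u0] [_ v0]; split=> // a aJ.
    by rewrite (linD (lphi a)) (linZ (lphi a)) u0 // v0 // scaler0 addr0.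
  + exact: finite_codim_kernel.
  + by move=> v [_ v0]; apply: exchange_fix => a; apply: v0; rewrite mem_index_enum.
- exists [set th | predual S th /\
    forall a, a \in index_enum J -> (th (x a - y a) : K^o) = 0]; split.
  + split; first by split=> //; case: sS.
    move=> c u v [Su u0] [Sv v0]; split; first by case: sS => _; apply.
    by move=> a aJ; rewrite !fctE u0 // v0 // scaler0 addr0.
  + by move=> th [].
  + exact: (@finite_codim_kernel _ _ _ _ _ (fun a (th : V -> K^o) => th (x a - y a))).
  + move=> th [Sth th0]; rewrite (dual_act_cancel gK g'K) dual_form; last first.
      exact: predual_linear Sth.
    rewrite big1 ?add0r // => a _.
    by rewrite th0 ?mem_index_enum // scale0r.
Qed.

(** The fixed complement of the exchange being orthogonal to both systems, only
    the Gram matrices matter. *)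
Lemma exchange_ind_group :
  (forall w, form_of S = Some w ->
    [/\ forall a b, w (x a) (x b) = w (y a) (y b),
        forall a u, (forall b, phi b u = 0) -> w (x a) u = 0
      & forall a u, (forall b, psi b u = 0) -> w (y a) u = 0]) ->
  ind_group S g.
Proof.
move=> form; split; first exact: exchange_GL.
case fS : (form_of S) => [w|//] u v; have [gram wx wy] := form w fS.
pose p z := \sum_a phi a z *: x a.
pose r z := z - p z.
have r0 z a : phi a (r z) = 0.
  by rewrite (linB (lphi a)) biorthogonal_sum // subrr.
have gE z : g z = \sum_a phi a z *: y a + r z.
  rewrite /g /exchange; under eq_bigr do rewrite scalerBr.
  by rewrite sumrB addrCA.
have zE z : z = \sum_a phi a z *: x a + r z by rewrite addrC subrK.
move: (r) r0 gE zE => {}r r0 gE zE.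
have orth (t : J -> V) z (c : J -> K) : (forall a, w (t a) (r z) = 0) ->
    w (\sum_a c a *: t a) (r z) = 0 /\ w (r z) (\sum_a c a *: t a) = 0.
  move=> t0; suff e : w (\sum_a c a *: t a) (r z) = 0.
    by split=> //; rewrite (form_swap _ _ vS fS) e mulr0.
  by rewrite linear_sumlz big1 // => a _; rewrite linearZl_LR t0 mulr0.
have ox z a : w (x a) (r z) = 0 by apply: wx.
have oy z a : w (y a) (r z) = 0.
  by apply: wy; apply: (same_projection_ker lpsi ypsi xy).
rewrite !gE [in RHS](zE u) [in RHS](zE v) !linearDl !linearDr.
rewrite !(orth y _ _ _).1 // !(orth y _ _ _).2 //.
rewrite !(orth x _ _ _).1 // !(orth x _ _ _).2 //.
rewrite !addr0; congr (_ + _).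
rewrite !linear_sumlz; apply: eq_bigr => a _; rewrite !linear_sumr.
apply: eq_bigr => b _; rewrite !linearZl_LR !linearZr_LR /=.
by rewrite gram.
Qed.

End ExchangeGroup.

(** * Frames *)

Section Frames.
Variables (K : fieldType) (V : lmodType K) (S : ind_data V).
Hypothesis vS : valid_data S.

(** The functionals are taken in the predual because an element of the group has to
    preserve it. With a form, biorthogonality says that the [n] pairs are
    hyperbolic. *)
Definition frame n (X : 'I_n * bool -> V) (Phi : 'I_n * bool -> V -> K^o) :=
  [/\ forall a, predual S (Phi a), biorthogonal X Phi
    & forall w, form_of S = Some w -> forall k v,
        Phi (k, true) v = w v (X (k, false)) /\
        Phi (k, false) v = w (X (k, true)) v].

Lemma frame_linear n X Phi a : @frame n X Phi -> linear (Phi a).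
Proof. by move=> [SPhi _ _]; apply: predual_linear (SPhi a). Qed.

Lemma frame_formE n X Phi w k b v : @frame n X Phi -> form_of S = Some w ->
  w (X (k, b)) v = (if b then 1 else swap_sign S) * Phi (k, ~~ b) v.
Proof.
move=> [_ _ form] fS; have [e1 e2] := form w fS k v; case: b => /=.
  by rewrite e2 mul1r.
by rewrite e1 (form_swap _ _ vS fS).
Qed.

Definition orthogonal_frames n (X X0 : 'I_n * bool -> V)
    (Phi Phi0 : 'I_n * bool -> V -> K^o) :=
  forall a b, Phi a (X0 b) = 0 /\ Phi0 a (X b) = 0.

(** ** Moving a frame into the span of an orthogonal one *)

(** The [X a] go to the [Y a], which span the same space as the [X0 a], and the
    latter go to the [X a]; on the common kernel of the functionals dual to the
    [X a] this map does not depend on [Y]. *)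
Definition place n (X X0 Y : 'I_n * bool -> V) (Phi Phi0 : 'I_n * bool -> V -> K^o) :=
  exchange (fun c : 'I_n * bool + 'I_n * bool =>
              match c with inl a => X a | inr a => X0 a end)
    (fun c => match c with inl a => Y a | inr a => X a end)
    (fun c => match c with inl a => Phi a | inr a => Phi0 a end).

Section Place.
Variables (n : nat) (X X0 Y : 'I_n * bool -> V).
Variables (Phi Phi0 Psi : 'I_n * bool -> V -> K^o).
Hypotheses (fX : frame X Phi) (fX0 : frame X0 Phi0) (fY : frame Y Psi).
Hypothesis orth : orthogonal_frames X X0 Phi Phi0.
Hypothesis span : same_projection X0 Y Phi0 Psi.

Let x (c : 'I_n * bool + 'I_n * bool) :=
  match c with inl a => X a | inr a => X0 a end.
Let y (c : 'I_n * bool + 'I_n * bool) :=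
  match c with inl a => Y a | inr a => X a end.
Let phi (c : 'I_n * bool + 'I_n * bool) :=
  match c with inl a => Phi a | inr a => Phi0 a end.
Let psi (c : 'I_n * bool + 'I_n * bool) :=
  match c with inl a => Psi a | inr a => Phi a end.

Let Psi_X a b : Psi a (X b) = 0.
Proof.
apply: (same_projection_ker _ _ span) => [c||c]; first exact: frame_linear fY.
  by case: fY.
by have [] := orth c b.
Qed.

Let Phi_Y a b : Phi a (Y b) = 0.
Proof.
have lPhi := frame_linear a fX; have [_ bY _] := fY.
have -> : Y b = \sum_c Phi0 c (Y b) *: X0 c.
  rewrite span (bigD1 b) //= big1 => [|c cb]; first by rewrite bY eqxx addr0 scale1r.
  by rewrite bY (negPf cb) scale0r.
rewrite (lin_sum lPhi) big1 // => c _; rewrite (linZ lPhi).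
by have [-> _] := orth a c; rewrite scaler0.
Qed.

Let Sphi c : predual S (phi c).
Proof. by have [SX _ _] := fX; have [SX0 _ _] := fX0; case: c => a /=. Qed.

Let Spsi c : predual S (psi c).
Proof. by have [SX _ _] := fX; have [SY _ _] := fY; case: c => a /=. Qed.

Let xphi : biorthogonal x phi.
Proof.
have [_ bX _] := fX; have [_ bX0 _] := fX0.
by move=> [a|a] [b|b] /=; rewrite ?bX ?bX0 //; have [] := orth a b;
   have [] := orth b a.
Qed.

Let ypsi : biorthogonal y psi.
Proof.
have [_ bX _] := fX; have [_ bY _] := fY.
by move=> [a|a] [b|b] /=; rewrite ?bX ?bY ?Psi_X ?Phi_Y.
Qed.

Let xy : same_projection x y phi psi.
Proof. by move=> v; rewrite !big_sumType /= addrC; congr (_ + _). Qed.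

Lemma place_ind_group : ind_group S (place X X0 Y Phi Phi0).
Proof.
apply: (exchange_ind_group vS Sphi Spsi xphi ypsi xy) => w fS.
have ker (Z : 'I_n * bool -> V) Ze a u :
    frame Z Ze -> (forall b, Ze b u = 0) -> w (Z a) u = 0.
  by case: a => k b fZ u0; rewrite (frame_formE _ _ _ fZ fS) u0 mulr0.
split.
- have gram (Z Z' : 'I_n * bool -> V) Ze Ze' a b : frame Z Ze -> frame Z' Ze' ->
      w (Z a) (Z b) = w (Z' a) (Z' b).
    case: a => k c fZ fZ'.
    rewrite (frame_formE _ _ _ fZ fS) (frame_formE _ _ _ fZ' fS).
    by have [_ -> _] := fZ; have [_ -> _] := fZ'.
  have XX0 a b : w (X a) (X0 b) = 0.
    by apply: (ker X Phi) => // c; have [] := orth c b.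
  have YX a b : w (Y a) (X b) = 0 by apply: (ker Y Psi).
  have sym u v : w u v = 0 -> w v u = 0.
    by move=> e; rewrite (form_swap _ _ vS fS) e mulr0.
  move=> [a|a] [b|b] /=.
  + exact: gram fX fY.
  + by rewrite XX0 YX.
  + by rewrite (sym _ _ (XX0 b a)) (sym _ _ (YX b a)).
  + exact: gram fX0 fX.
- move=> [a|a] u u0 /=; [apply: (ker X Phi) | apply: (ker X0 Phi0)] => // b.
    exact: (u0 (inl b)).
  exact: (u0 (inr b)).
- move=> [a|a] u u0 /=; [apply: (ker Y Psi) | apply: (ker X Phi)] => // b.
    exact: (u0 (inl b)).
  exact: (u0 (inr b)).
Qed.

Lemma place_vec a : place X X0 Y Phi Phi0 (X a) = Y a.
Proof. exact: (exchange_vec y (inl a) xphi). Qed.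

Lemma place_coord a v : Psi a (place X X0 Y Phi Phi0 v) = Phi a v.
Proof.
have lpsi c : linear (psi c) by apply: predual_linear (Spsi c).
exact: (coord_exchange lpsi ypsi xy (inl a)).
Qed.

End Place.

Lemma place_ker n X X0 Y Y' Phi Phi0 v : (forall a, Phi a v = 0) ->
  @place n X X0 Y Phi Phi0 v = place X X0 Y' Phi Phi0 v.
Proof.
move=> v0; rewrite /place /exchange !big_sumType /=.
by congr (_ + (_ + _)); rewrite !big1 // => a _; rewrite v0 scale0r.
Qed.

End Frames.

(** * Frames made of basis vectors *)

Section BasedFrames.
Variables (K : fieldType) (V : lmodType K).
Implicit Types (S : ind_data V) (E I : set V).

(** Entries of equal rank in the two lists are meant to become, after rescaling, the
    pairs of a frame. *)
Definition pairable S E (p q : seq V) :=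
  [/\ size p = size q, uniq (p ++ q), [set` p ++ q] `<=` E
    & forall w, form_of S = Some w -> forall k, (k < size p)%N ->
        w p`_k q`_k != 0].

Definition pair_vec n (p q : seq V) (a : 'I_n * bool) : V :=
  (if a.2 then p else q)`_(a.1).

Definition based_frame S E n (u X : 'I_n * bool -> V)
    (Phi : 'I_n * bool -> V -> K^o) :=
  [/\ frame S X Phi, forall a, exists c, X a = c *: u a
    & forall a e, E e -> e != u a -> Phi a e = 0].

Lemma pair_vec_inj p q n : size p = n -> size q = n -> uniq (p ++ q) ->
  injective (@pair_vec n p q).
Proof.
move=> sp sq upq.
have idx (a : 'I_n * bool) : pair_vec p q a = (p ++ q)`_(a.1 + ~~ a.2 * n).
  case: a => k [] /=; rewrite /pair_vec nth_cat sp /= ?mul0n ?addn0 ?ltn_ord //.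
  by rewrite mul1n ltnNge leq_addl addnK.
move=> [k b] [l c]; rewrite !idx /= => /eqP; rewrite nth_uniq //; last 2 first.
- rewrite size_cat sp sq; case: b => /=; rewrite ?mul0n ?mul1n ?addn0.
    by apply: ltn_addr.
  by rewrite ltn_add2r.
- rewrite size_cat sp sq; case: c => /=; rewrite ?mul0n ?mul1n ?addn0.
    by apply: ltn_addr.
  by rewrite ltn_add2r.
case: b; case: c => /=; rewrite ?mul0n ?mul1n ?addn0 ?eqn_add2r => /eqP e.
- by congr (_, _); apply: val_inj.
- by have := ltn_ord k; rewrite e ltnNge leq_addl.
- by have := ltn_ord l; rewrite -e ltnNge leq_addl.
- by congr (_, _); apply: val_inj.
Qed.

Lemma pair_vec_mem p q n (a : 'I_n * bool) : size p = n -> size q = n ->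
  pair_vec p q a \in (if a.2 then p else q).
Proof. by case: a => k [] /= sp sq; rewrite /pair_vec /= mem_nth ?sp ?sq. Qed.

(** Without a form, the dual basis vectors belong to [V_*], because they span it
    and it separates the points of [V]. *)
Lemma dual_basis_vec W E e : valid_data (TypeA W) -> admissible (TypeA W) E ->
  E e -> exists phi : V -> K^o, [/\ W phi, phi e = 1
    & forall e', E e' -> e' != e -> phi e' = 0].
Proof.
move=> [sW lW _ sep] [[iE _] /= dE] Ee.
have e0 : e != 0.
  apply/eqP => e0; have := iE [:: e] (fun=> 1) isT _ _ e (mem_head _ _).
  move=> /(_ _ _)/eqP; rewrite oner_eq0 => h; suff: false by []; apply: h.
    by move=> x /=; rewrite inE => /eqP->.
  by rewrite big_seq1 e0 scaler0.
have [phi Wphi phie] : exists2 phi, W phi & phi e <> 0.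
  apply: contrapT => h; move/eqP: e0; apply; apply: sep => phi Wphi.
  by apply: contrapT => phie; apply: h; exists phi.
move: (Wphi); rewrite -dE => -[s [a [sE phiE]]].
have [chi [lchi [e1 Ee1 chiE]] chie] : exists2 chi, dual_family E chi & chi e <> 0.
  apply: contrapT => h; apply: phie; rewrite phiE fct_sumE big_seq big1 // => chi chis.
  rewrite /= fctE; suff -> : chi e = 0 by rewrite scaler0.
  by apply: contrapT => ne; apply: h; exists chi => //; apply: sE.
have e1e : e = e1.
  by apply/eqP; apply: contrapT => /negP/negPf ne; apply: chie; rewrite chiE // ne.
rewrite -e1e in chiE; exists chi; split.
- by apply: lspan_mem; split=> //; exists e.
- by rewrite chiE // eqxx.
- by move=> e' Ee' /negPf ne; rewrite chiE // ne.
Qed.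

Lemma based_frame_exists S E p q n : valid_data S -> admissible S E ->
  pairable S E p q -> size p = n ->
  exists X Phi, based_frame S E (@pair_vec n p q) X Phi.
Proof.
move=> vS aE [spq upq pqE prd] sp; have sq : size q = n by rewrite -spq.
have inj := pair_vec_inj sp sq upq.
have uE (a : 'I_n * bool) : E (pair_vec p q a).
  apply: pqE => /=; rewrite mem_cat; have := @pair_vec_mem p q n a sp sq.
  by case: a.2 => ->; rewrite ?orbT.
case fS : (form_of S) => [w|]; last first.
  case: S vS aE pqE prd uE fS => // W vS aE pqE prd uE _.
  have /choice[Phi PhiP] := fun a => dual_basis_vec vS aE (uE a).
  exists (pair_vec p q), Phi; split.
  - split=> // [a|a b]; have [? Pa Pb] := PhiP a; first by [].
    have [<-|ab] := eqVneq; first by rewrite Pa.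
    by apply: Pb => //; apply: contraNneq ab => /inj->.
  - by move=> a; exists 1; rewrite scale1r.
  - by move=> a e Ee; have [_ _] := PhiP a; apply.
have [_] := aE; rewrite fS => -[iE [iEE _ iEP]].
pose d (k : 'I_n) := w (pair_vec p q (k, true)) (pair_vec p q (k, false)).
have d0 (k : 'I_n) : d k != 0.
  by have := prd w fS k; rewrite sp => /(_ (ltn_ord k)).
have iEp (k : 'I_n) : pair_vec p q (k, false) = iE (pair_vec p q (k, true)).
  by apply/iEP => //; apply: d0.
have w0 e e' : E e -> E e' -> e' != iE e -> w e e' = 0.
  by move=> Ee Ee' /eqP ne; apply: contrapT => /eqP /(iEP _ _ Ee Ee').
pose X (a : 'I_n * bool) :=
  (if a.2 then 1 else (d a.1)^-1) *: pair_vec p q a.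
pose Phi (a : 'I_n * bool) : V -> K^o :=
  if a.2 then (fun v => w v (X (a.1, false))) else w (X (a.1, true)).
have PhiE a e : Phi a e = (if a.2 then (d a.1)^-1 * w e (pair_vec p q (a.1, false))
    else w (pair_vec p q (a.1, true)) e).
  by case: a => k []; rewrite /Phi /X /= ?linearZr_LR // scale1r.
have vanish a e : E e -> e != pair_vec p q a -> Phi a e = 0.
  rewrite PhiE; case: a => k [] /= Ee ne; last by apply: w0 => //; rewrite -iEp.
  rewrite (w0 e _ Ee (uE _)) ?mulr0 //; apply: contraNneq ne => h.
  have [_ ik] := iEE _ (uE (k, true)); have [_ ie] := iEE _ Ee.
  by rewrite -ik -iEp h ie.
exists X, Phi; split.
- split=> [[k []]|a b|w'].
  + rewrite (_ : Phi _ = w (swap_sign S *: X (k, false))).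
      exact: predual_form fS.
    apply/funext => v; rewrite linearZl_LR -(form_swap _ _ vS fS).
    by [].
  + exact: predual_form fS.
  + have lPhi : linear (Phi a).
      case: a => k [] /=; last exact: form_linr.
      by move=> c u v; rewrite /Phi /= linearPl.
    rewrite /X (linZ lPhi); have [<-|ab] := eqVneq a b; last first.
      by rewrite vanish ?scaler0 //; apply: contraNneq ab => /inj->.
    rewrite PhiE; case: a {lPhi} => k [] /=; rewrite -/(d k) ?scale1r ?mulVf //.
    by rewrite [_ *: _]mulVf.
  + by rewrite fS => -[<-].
- by move=> a; exists (if a.2 then 1 else (d a.1)^-1).
- exact: vanish.
Qed.

End BasedFrames.

(** * Selecting frames adapted to a coordinate subspace *)

Section Selection.
Variables (K : fieldType) (V : lmodType K) (S : ind_data V) (E : set V).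
Hypotheses (vS : valid_data S) (aE : admissible S E) (infE : infinite_set E).

Lemma span_admissible v : lspan E v.
Proof. by have [[_ ->] _] := aE. Qed.

Lemma admissible_involution w : form_of S = Some w ->
  exists iE : V -> V,
    [/\ forall e, E e -> E (iE e) /\ iE (iE e) = e,
        forall e e', E e -> E e' -> iE e = e -> iE e' = e' -> e = e'
      & forall e e', E e -> E e' -> (w e e' != 0 <-> e' = iE e)].
Proof. by move=> fS; have [_] := aE; rewrite fS. Qed.

(** A basis vector may be its own partner, but two different ones cannot. *)
Lemma fresh_pair (avoid : seq V) : exists e f,
  [/\ E e, E f, e != f, (e \notin avoid) && (f \notin avoid)
    & forall w, form_of S = Some w -> w e f != 0].
Proof.
case fS : (form_of S) => [w|]; last first.
  have [e Ee ea] := infinite_notin avoid infE.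
  have [f Ef] := infinite_notin (e :: avoid) infE.
  rewrite inE negb_or => /andP[fe fa].
  by exists e, f; split; rewrite // 1?eq_sym // ea.
have [iE [iEE fixE iEP]] := admissible_involution fS.
have [e [Ee ea ie]] : exists e, [/\ E e, e \notin avoid ++ map iE avoid & iE e != e].
  have [e Ee ea] := infinite_notin (avoid ++ map iE avoid) infE.
  have [ee|ne] := eqVneq (iE e) e; last by exists e.
  have [f Ef] := infinite_notin (e :: avoid ++ map iE avoid) infE.
  rewrite inE negb_or => /andP[fe fa].
  by exists f; split=> //; apply: contraNneq fe => ff; apply/eqP; apply: fixE.
have [Ei iK] := iEE _ Ee; exists e, (iE e); split=> //; first by rewrite eq_sym.
  move: ea; rewrite mem_cat negb_or => /andP[-> /= ea].
  by apply: contraNN ea => h; rewrite -iK; apply: map_f.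
by move=> w' [<-]; apply/iEP.
Qed.

Lemma pairable_cat p q p' q' : pairable S E p q -> pairable S E p' q' ->
  (forall x, x \in p' ++ q' -> x \notin p ++ q) ->
  pairable S E (p ++ p') (q ++ q').
Proof.
move=> [sp up pE wp] [sp' up' pE' wp'] dis.
have perm : perm_eq ((p ++ p') ++ (q ++ q')) ((p ++ q) ++ (p' ++ q')).
  by apply/permPl/perm_catACA.
split.
- by rewrite !size_cat sp sp'.
- rewrite (perm_uniq perm) cat_uniq up up' andbT /=.
  by apply/hasPn => x /dis.
- move=> x /=; rewrite (perm_mem perm) mem_cat => /orP[]; [exact: pE | exact: pE'].
- move=> w fS k; rewrite size_cat !nth_cat -sp => kp; case: ltnP => h.
    exact: wp.
  by apply: wp'; rewrite // ltn_subLR.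
Qed.

Lemma fresh_pairs (avoid : seq V) n : exists p q,
  [/\ pairable S E p q, size p = n & forall x, x \in p ++ q -> x \notin avoid].
Proof.
elim: n => [|n [p [q [prd sp av]]]].
  by exists [::], [::]; split=> //; split.
have [e [f [Ee Ef ef /andP[ea fa] wef]]] := fresh_pair (avoid ++ (p ++ q)).
move: ea fa; rewrite !(mem_cat _ avoid) !negb_or => /andP[ea ep] /andP[fa fp].
exists (p ++ [:: e]), (q ++ [:: f]); split.
- apply: pairable_cat => //; last first.
    by move=> x; rewrite !inE => /orP[] /eqP->.
  split=> //=; first by rewrite inE ef.
    by move=> x /=; rewrite !inE => /orP[] /eqP->.
  by move=> w fS [|k] // _; apply: wef.
- by rewrite size_cat sp addn1.
- move=> x; rewrite !mem_cat !inE => /orP[] /orP[xp|/eqP->] //.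
    by apply: av; rewrite mem_cat xp.
  by apply: av; rewrite mem_cat xp orbT.
Qed.

Lemma predual_support th : predual S th ->
  exists t : seq V, forall e, E e -> e \notin t -> th e = 0.
Proof.
move=> Sth; case fS : (form_of S) => [w|].
  have [iE [iEE _ iEP]] := admissible_involution fS.
  have [z ->] : exists z, th = w z.
    by case: S fS Sth => // w' [<-] [z _ <-]; exists z.
  have [s [a [sE ->]]] := span_admissible z.
  exists (map iE s) => e Ee es; rewrite linear_sumlz big_seq big1 // => x xs.
  rewrite linearZl_LR; suff -> : w x e = 0 by rewrite mulr0.
  apply: contrapT => /eqP; rewrite iEP //; last exact: sE.
  by move=> ex; rewrite ex map_f in es.
case: S aE fS Sth => // W [_ /= <-] _ [s [a [sE ->]]].
have /choice[c cP] : forall chi : V -> K^o, exists c : V,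
    chi \in s -> forall e, E e -> e != c -> chi e = 0.
  move=> chi; have [/sE[_ [c _ chiE]]|_] := boolP (chi \in s); last by exists 0.
  by exists c => _ e Ee /negPf ne; rewrite chiE // ne.
exists (map c s) => e Ee es; rewrite fct_sumE big_seq big1 // => chi chis.
rewrite fctE (cP chi) ?scaler0 //; apply: contraNneq es => ->.
exact: map_f.
Qed.

(** Only finitely many basis vectors are involved in finitely many frames. *)
Lemma fresh_frame (J : finType) n (X : J -> 'I_n * bool -> V)
    (Phi : J -> 'I_n * bool -> V -> K^o) :
  (forall i, frame S (X i) (Phi i)) ->
  exists X0 Phi0, frame S X0 Phi0 /\
    forall i, @orthogonal_frames _ _ n (X i) X0 (Phi i) Phi0.
Proof.
move=> fX.
have lPhi i a : linear (Phi i a) by apply: (frame_linear vS a (fX i)).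
have /choice[t tP] : forall c : J * ('I_n * bool), exists t : seq V,
    forall e, E e -> e \notin t -> Phi c.1 c.2 e = 0.
  by move=> c; apply: predual_support; case: (fX c.1).
have /choice[s sP] : forall c : J * ('I_n * bool), exists s : seq V,
    forall phi : V -> K^o, linear phi ->
      (forall e, E e -> e \in s -> phi e = 0) -> phi (X c.1 c.2) = 0.
  move=> c; have [s [a [sE ->]]] := span_admissible (X c.1 c.2).
  exists s => phi lphi phi0; rewrite (lin_sum lphi) big_seq big1 // => x xs.
  by rewrite (linZ lphi) phi0 ?scaler0 //; apply: sE.
pose avoid := flatten [seq t c ++ s c | c <- enum {: J * ('I_n * bool)}].
have [p [q [prd sp av]]] := fresh_pairs avoid n.
have sq : size q = n by case: prd => <-.
have [X0 [Phi0 [fX0 Xu vanish]]] := based_frame_exists vS aE prd sp.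
have uav (a : 'I_n * bool) : pair_vec p q a \notin avoid.
  apply: av; have := pair_vec_mem a sp sq; rewrite mem_cat.
  by case: a.2 => ->; rewrite ?orbT.
have notin (a : 'I_n * bool) c : (pair_vec p q a \notin t c) && (pair_vec p q a \notin s c).
  rewrite -negb_or -mem_cat; apply: contraNN (uav a) => h; apply/flatten_mapP.
  by exists c; rewrite // mem_enum.
have uE a : E (@pair_vec K V n p q a).
  have [_ _ pqE _] := prd; apply: pqE => /=; rewrite mem_cat.
  by have := pair_vec_mem a sp sq; case: a.2 => ->; rewrite ?orbT.
exists X0, Phi0; split=> // i a b; split.
  have [c ->] := Xu b; rewrite (linZ (lPhi i a)) (tP (i, a)) ?scaler0 //.
  by have /andP[] := notin b (i, a).
apply: (sP (i, b)); first exact: frame_linear fX0.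
move=> e Ee es; apply: vanish => //; have /andP[_] := notin a (i, b).
by apply: contraNneq => <-.
Qed.

Section Subspace.
Variable I : set V.
Hypothesis IE : I `<=` E.
Hypothesis isoI : forall w, form_of S = Some w -> forall e e', I e -> I e' -> w e e' = 0.

Section BasedFrame.
Variables (n : nat) (u X : 'I_n * bool -> V) (Phi : 'I_n * bool -> V -> K^o).
Hypothesis bX : based_frame S E u X Phi.

Let lPhi a : linear (Phi a).
Proof. by have [fX _ _] := bX; apply: frame_linear fX. Qed.

Lemma based_frame_mem a : I (u a) -> lspan I (X a).
Proof.
have [_ Xu _] := bX; have [c ->] := Xu a => Iu.
by apply: subspaceZ; [exact: lspan_subspace | exact: lspan_mem].
Qed.

Lemma based_frame_vanish a v : ~ I (u a) -> lspan I v -> Phi a v = 0.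
Proof.
move=> Iu [s [c [sI ->]]]; rewrite (lin_sum (lPhi a)) big_seq big1 // => x xs.
have [_ _ van] := bX; rewrite (linZ (lPhi a)) van ?scaler0 //.
  by apply: IE; apply: sI.
by apply: contra_notN Iu => /eqP <-; apply: sI.
Qed.

Lemma based_frame_scale a : exists2 c, c != 0 & X a = c *: u a.
Proof.
have [[_ bio _] Xu _] := bX; have [c Xc] := Xu a; exists c => //.
apply/eqP => c0; have := bio a a; rewrite Xc c0 scale0r (lin0 (lPhi a)) eqxx.
by move/esym/eqP; rewrite oner_eq0.
Qed.

Lemma based_frame_sum v : (forall e, I e -> exists a, e = u a) -> lspan I v ->
  v = \sum_a Phi a v *: X a.
Proof.
move=> Iu; move: v; apply: lspan_sub => [|e /Iu[a ->]].
  split; first by rewrite big1 // => a _; rewrite (lin0 (lPhi a)) scale0r.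
  move=> c x y hx hy; rewrite {1}hx {1}hy scaler_sumr -big_split.
  apply: eq_bigr => a _ /=.
  by rewrite (linD (lPhi a)) (linZ (lPhi a)) scalerA -scalerDl.
have [c c0 Xc] := based_frame_scale a.
have -> : u a = c^-1 *: X a by rewrite Xc scalerA mulVf // scale1r.
have [[_ bio _] _ _] := bX; rewrite (bigD1 a) //= big1 => [|b ba].
  by rewrite (linZ (lPhi a)) bio eqxx addr0 [_ *: 1]mulr1.
by rewrite (linZ (lPhi b)) bio (negPf ba) scaler0 scale0r.
Qed.

Lemma based_frame_kernel v : (forall e, E e -> ~ I e -> exists k, e = u (k, false)) ->
  (forall k, Phi (k, false) v = 0) -> lspan I v.
Proof.
move=> EI v0.
(* A list without repetition, so that each functional reads off one coefficient. *)
have [s [a [sE vs]]] := span_admissible v.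
have [t [b [ut tE vt]]] : exists t (b : V -> K),
    [/\ uniq t, [set` t] `<=` E & v = \sum_(x <- t) b x *: x].
  exists (undup s), (fun x => a x *+ count_mem x s); split=> [||].
  - exact: undup_uniq.
  - by move=> x /=; rewrite mem_undup; apply: sE.
  - rewrite vs; apply: sum_uniq_supset; first exact: undup_uniq.
    by move=> x; rewrite mem_undup.
rewrite vt big_seq; apply: subspace_sum; first exact: lspan_subspace.
move=> x xt; have sI := @lspan_subspace K V I.
have [Ix|nIx] := pselect (I x); first by apply: subspaceZ => //; apply: lspan_mem.
suff -> : b x = 0 by rewrite scale0r; case: sI.
have [k xu] := EI _ (tE _ xt) nIx; have [c c0 Xc] := based_frame_scale (k, false).
have [[_ bio _] _ van] := bX.
have Phix : Phi (k, false) x != 0.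
  have -> : x = c^-1 *: X (k, false) by rewrite Xc scalerA mulVf // scale1r.
  by rewrite (linZ (lPhi _)) bio eqxx [_ *: _]mulr1 invr_eq0.
move: (v0 k); rewrite vt (lin_sum (lPhi _)) (bigD1_seq x) //= big_seq_cond big1.
  by rewrite addr0 (linZ (lPhi _)) => /eqP; rewrite mulf_eq0 (negPf Phix) orbF => /eqP.
move=> y /andP[yt yx]; rewrite (linZ (lPhi _)) van ?scaler0 //; first exact: tE.
by rewrite -xu.
Qed.

End BasedFrame.
End Subspace.
End Selection.

Section AdaptedFrames.
Variables (K : fieldType) (V : lmodType K) (S : ind_data V) (E I : set V).
Hypotheses (vS : valid_data S) (aE : admissible S E) (infE : infinite_set E).
Hypothesis IE : I `<=` E.
Hypothesis isoI :
  forall w, form_of S = Some w -> forall e e', I e -> I e' -> w e e' = 0.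

(** The partner of a vector of an isotropic [I] pairs nontrivially with it, hence
    lies outside [I]. *)
Lemma isotropic_partners w s : form_of S = Some w -> uniq s -> [set` s] `<=` I ->
  exists q, pairable S E s q /\ forall x, x \in q -> ~ I x.
Proof.
move=> fS us sI; have [iE [iEE _ iEP]] := admissible_involution aE fS.
have out x : I x -> ~ I (iE x).
  move=> Ix Iix; have [Ei _] := iEE _ (IE Ix).
  by have /iEP := erefl (iE x); rewrite (isoI fS) // eqxx => /(_ (IE Ix) Ei).
have qI x : x \in map iE s -> ~ I x by move=> /mapP[y /sI Iy ->]; apply: out.
exists (map iE s); split=> //; split.
- by rewrite size_map.
- rewrite cat_uniq us /=; apply/andP; split.
    by apply/hasPn => x /qI nIx; apply/negP => /sI.
  rewrite map_inj_in_uniq // => x y /sI/IE Ex /sI/IE Ey exy.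
  by have [_ <-] := iEE _ Ex; have [_ <-] := iEE _ Ey; rewrite exy.
- move=> x /=; rewrite mem_cat => /orP[/sI/IE //|/mapP[y /sI/IE Ey ->]].
  by have [] := iEE _ Ey.
- move=> w'; rewrite fS => -[<-] k ks; rewrite (nth_map 0) //.
  have Es : E s`_k by apply/IE/sI; rewrite /= mem_nth.
  by have [Ei _] := iEE _ Es; apply/iEP.
Qed.

Lemma pairable_formless p q : form_of S = None -> size p = size q ->
  uniq (p ++ q) -> [set` p ++ q] `<=` E -> pairable S E p q.
Proof. by move=> fS spq u sE; split=> // w; rewrite fS. Qed.

(** A subspace that is neither too small nor too large has arbitrarily long
    frames whose first halves lie inside and whose second halves lie outside. *)
Lemma frame_split n : infinite_set I ->
  (form_of S = None -> infinite_set (E `\` I)) ->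
  exists X Phi, @frame K V S n X Phi /\ forall k,
    lspan I (X (k, true)) /\ forall v, lspan I v -> Phi (k, false) v = 0.
Proof.
move=> infI infEI.
have [s [ss us sI _]] := infinite_uniq_extend [::] n infI.
have [q [prd qI]] : exists q, pairable S E s q /\ forall x, x \in q -> ~ I x.
  case fS : (form_of S) => [w|]; first exact: (isotropic_partners fS us sI).
  have [q [sq uq qE _]] := infinite_uniq_extend [::] n (infEI fS).
  exists q; split; last by move=> x /qE[].
  apply: pairable_formless => //; first by rewrite ss sq.
    rewrite cat_uniq us uq andbT; apply/hasPn => x /qE[_ nIx].
    by apply/negP => /sI.
  by move=> x /=; rewrite mem_cat => /orP[/sI/IE //|/qE[]].
have [X [Phi bX]] := based_frame_exists vS aE prd ss.
have sq : size q = n by case: prd => <-.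
exists X, Phi; split=> [|k]; first by case: bX.
split; first by apply: (based_frame_mem bX); apply: sI; rewrite /= mem_nth ?ss.
by move=> v; apply: (based_frame_vanish vS IE bX); apply: qI; rewrite mem_nth ?sq.
Qed.

Lemma frame_small s f m : uniq s -> [set` s] `<=` I -> size s = m.+1 ->
  E f -> ~ I f -> exists X Phi, [/\ @frame K V S m.+1 X Phi,
    forall k, lspan I (X (k, true)),
    forall v, lspan I v -> Phi (ord0, false) v = 0
  & I `<=` [set` s] -> forall v, lspan I v ->
      v = \sum_k Phi (k, true) v *: X (k, true)].
Proof.
move=> us sI ss Ef nIf.
have [q [prd qI0 qI]] : exists q, [/\ pairable S E s q, ~ I q`_0
    & I `<=` [set` s] -> forall x, x \in q -> ~ I x].
  case fS : (form_of S) => [w|].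
    have [q [prd qI]] := isotropic_partners fS us sI; exists q; split=> //.
    by apply: qI; rewrite mem_nth //; case: prd => <-; rewrite ss.
  have [t [st ut tE ta]] := infinite_uniq_extend (f :: s) m infE.
  have fs : f \notin s by apply/negP => /sI.
  exists (f :: t); split=> // [|Is x].
    apply: pairable_formless => //=; first by rewrite ss st.
      rewrite cat_uniq us /= ut negb_or fs /=.
      have -> : f \notin t by apply/negP => /ta; rewrite mem_head.
      rewrite !andbT; apply/hasPn => x /ta; rewrite inE negb_or.
      by case/andP.
    move=> x /=; rewrite mem_cat inE => /orP[/sI/IE //|/orP[/eqP->|/tE]] //.
  rewrite inE => /orP[/eqP-> //|/ta]; rewrite inE negb_or => /andP[_ xs].
  by move=> /Is /= xs'; rewrite xs' in xs.
have [X [Phi bX]] := based_frame_exists vS aE prd ss.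
have sq : size q = m.+1 by case: prd => <-.
exists X, Phi; split=> [|k|v Iv|Is v Iv].
- by case: bX.
- by apply: (based_frame_mem bX); apply: sI; rewrite /= mem_nth ?ss.
- exact: (based_frame_vanish vS IE bX).
- rewrite {1}(based_frame_sum vS bX _ Iv); last first.
    move=> e /Is /= es; have es' : (index e s < m.+1)%N by rewrite -ss index_mem.
    by exists (Ordinal es', true); rewrite /pair_vec /= nth_index.
  rewrite (eq_bigr (fun a => Phi (a.1, a.2) v *: X (a.1, a.2))); last by case.
  rewrite -(pair_bigA _ (fun k b => Phi (k, b) v *: X (k, b))) /=.
  apply: eq_bigr => k _; rewrite big_bool /= [X in _ + X](_ : _ = 0) ?addr0 //.
  rewrite (based_frame_vanish vS IE bX) ?scale0r //.
  by apply: qI => //; rewrite mem_nth ?sq.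
Qed.

Lemma frame_cosmall s e m : form_of S = None -> uniq s ->
  (forall x, x \in s -> E x /\ ~ I x) -> size s = m.+1 -> I e ->
  exists X Phi, [/\ @frame K V S m.+1 X Phi,
    lspan I (X (ord0, true)),
    forall k v, lspan I v -> Phi (k, false) v = 0
  & E `\` I `<=` [set` s] -> forall v, (forall k, Phi (k, false) v = 0) -> lspan I v].
Proof.
move=> fS us sE ss Ie.
have [t [st ut tE ta]] := infinite_uniq_extend (e :: s) m infE.
have es : e \notin s by apply/negP => /sE[].
have prd : pairable S E (e :: t) s.
  apply: pairable_formless => //=; first by rewrite ss st.
    rewrite mem_cat negb_or es cat_uniq ut us !andbT /=; apply/andP; split.
      by apply/negP => /ta; rewrite mem_head.
    apply/hasPn => x xs; apply/negP => /ta; rewrite inE xs orbT.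
    by [].
  move=> x /=; rewrite inE mem_cat => /orP[/eqP->|/orP[/tE|/sE[]]] //.
  exact: IE.
have [X [Phi bX]] := based_frame_exists vS aE prd (congr1 succn st).
exists X, Phi; split=> [||k v Iv|Es v v0].
- by case: bX.
- exact: (based_frame_mem bX).
- apply: (based_frame_vanish vS IE bX) => // Ik.
  by have [|_ []] := sE s`_k; first by rewrite mem_nth ?ss.
- apply: (based_frame_kernel vS aE bX) => // x Ex nIx.
  have /= xs := Es x (conj Ex nIx).
  have xs' : (index x s < m.+1)%N by rewrite -ss index_mem.
  by exists (Ordinal xs'); rewrite /pair_vec /= nth_index.
Qed.

Lemma frame_isotropic w s n : form_of S = Some w -> uniq s -> I = [set` s] ->
  (size s <= n)%N -> exists X Phi, [/\ @frame K V S n X Phi,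
    forall k : 'I_n, (k < size s)%N -> lspan I (X (k, true)),
    forall k v, lspan I v -> Phi (k, false) v = 0
  & forall r v, (size s <= r)%N -> lspan I v ->
      v = \sum_(k < n | (k < r)%N) Phi (k, true) v *: X (k, true)].
Proof.
move=> fS us Is sn; have sI : [set` s] `<=` I by rewrite Is.
have [q [prd qI]] := isotropic_partners fS us sI.
have [p' [q' [prd' sp' av]]] := fresh_pairs aE infE (s ++ q) (n - size s).
have {}prd' := pairable_cat prd prd' av.
have sp : size (s ++ p') = n by rewrite size_cat sp' subnKC.
have [X [Phi bX]] := based_frame_exists vS aE prd' sp.
have p'I x : x \in p' ++ q' -> ~ I x.
  by move=> /av; rewrite Is mem_cat negb_or => /andP[/negP].
have sq : size (q ++ q') = n by case: prd' => <-.
have fI k : ~ I ((q ++ q')`_k) \/ (n <= k)%N.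
  case: (ltnP k n) => kn; [left | by right].
  have : (q ++ q')`_k \in q ++ q' by rewrite mem_nth ?sq.
  rewrite mem_cat => /orP[/qI //|h]; apply: p'I.
  by rewrite mem_cat h orbT.
have van (k : 'I_n) v : lspan I v -> Phi (k, false) v = 0.
  apply: (based_frame_vanish vS IE bX); case: (fI k) => //.
  by rewrite leqNgt ltn_ord.
exists X, Phi; split=> // [|k ks|r v sr Iv]; first by case: bX.
  apply: (based_frame_mem bX); apply: sI.
  by rewrite /= /pair_vec /= nth_cat ks mem_nth.
rewrite {1}(based_frame_sum vS bX _ Iv); last first.
  rewrite Is => e /= es; have es' : (index e s < n)%N.
    by apply: leq_trans sn; rewrite index_mem.
  by exists (Ordinal es', true); rewrite /pair_vec /= nth_cat index_mem es nth_index.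
rewrite (eq_bigr (fun a => Phi (a.1, a.2) v *: X (a.1, a.2))); last by case.
rewrite -(pair_bigA _ (fun k b => Phi (k, b) v *: X (k, b))) /=.
rewrite [RHS]big_mkcond; apply: eq_bigr => k _; rewrite big_bool /=.
rewrite van // scale0r addr0; case: ltnP => // rk; have ks := leq_trans sr rk.
rewrite (based_frame_vanish vS IE bX) ?scale0r //; apply: p'I.
rewrite /pair_vec /= nth_cat ltnNge ks /= mem_cat mem_nth // sp'.
by rewrite ltn_sub2r // (leq_ltn_trans ks).
Qed.

End AdaptedFrames.

(** * Parabolic subgroups and orbits *)

Section Parabolics.
Variables (K : fieldType) (V : lmodType K) (S : ind_data V).
Hypothesis vS : valid_data S.

Lemma ind_group_id : ind_group S id.
Proof.
pose x (a : void) : V := match a with end.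
pose phi (a : void) : V -> K^o := match a with end.
suff -> : id = exchange x x phi.
  by apply: (exchange_ind_group vS (psi := phi)) => // -[].
by apply/funext => v; rewrite /exchange big1 ?addr0 // => -[].
Qed.

Lemma ind_group_finite_rank h : ind_group S h ->
  [/\ linear h, bijective h & exists s : seq V, forall v, lspan [set` s] (h v - v)].
Proof.
move=> [[lh bh _ [A [_ cA hA]] _] _]; split=> //.
exact: finite_rank_of_fixing cA hA.
Qed.

Lemma ind_group_image_sub h X : ind_group S h -> is_subspace X ->
  h @` X `<=` X -> h @` X = X.
Proof.
move=> /ind_group_finite_rank[lh bh rh] sX.
by apply: finite_rank_image => //; apply: bij_inj.
Qed.

(** The inverse of [h] also differs from the identity by a finite-rank map. *)
Lemma ind_group_image_sup h X : ind_group S h -> is_subspace X ->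
  X `<=` h @` X -> h @` X = X.
Proof.
move=> /ind_group_finite_rank[lh [h' hK h'K] [s sP]] sX Xh.
have lh' : linear h'.
  by move=> a u v; apply: (can_inj hK); rewrite h'K (linD lh) (linZ lh) !h'K.
have h'X : h' @` X = X.
  apply: finite_rank_image => //; first exact: can_inj h'K.
    exists s => v; rewrite -[v in X in _ - X]h'K -opprB -scaleN1r.
    by apply: subspaceZ => //; apply: lspan_subspace.
  by move=> _ [v /Xh[u Xu <-] <-]; rewrite hK.
rewrite -[in LHS]h'X; apply/seteqP; split=> [_ [_ [v Xv <-] <-]|v Xv].
  by rewrite h'K.
by exists (h' v); [exists v | rewrite h'K].
Qed.

(** Two members of a flag being comparable, an element that stabilizes the flag
    as a set stabilizes each of its members. *)
Lemma flag_stabilizer_member FF F g : generalized_flag S FF ->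
  flag_stabilizer S FF g -> FF F -> g @` F = F.
Proof.
move=> [sub tot _ _ _] [Gg gFF] FFF.
have FFg : FF (g @` F) by rewrite -gFF; exists F.
have [gF|Fg] := tot _ _ FFg FFF.
  by apply: ind_group_image_sub => //; apply: sub.
by apply: ind_group_image_sup => //; apply: sub.
Qed.

Lemma parabolic_subspace P : splitting_parabolic S P -> P `<` ind_group S ->
  P id /\ exists E I, [/\ admissible S E, I `<=` E,
    (exists e, I e) /\ (exists2 f, E f & ~ I f),
    forall w, form_of S = Some w -> forall e e', I e -> I e' -> w e e' = 0
  & forall p, P p -> p @` lspan I = lspan I].
Proof.
move=> [E [FF [aE flag compat ->]]] [_ proper]; split.
  by split; [exact: ind_group_id | rewrite eqEsubset; split=> F;
    [case=> H FFH <-; rewrite image_id | move=> FFF; exists F; rewrite ?image_id]].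
have [sub tot _ _ dual] := flag; have [[_ spanE] _] := aE.
suff [F [FFF F0 FT isoF]] : exists F, [/\ FF F, exists2 v, F v & v != 0,
    exists v, ~ F v
  & forall w, form_of S = Some w -> forall u v, F u -> F v -> w u v = 0].
  have [I IE FI] := compat F FFF; exists E, I; split=> //.
  - split.
      apply: contrapT => nI; have [v Fv] := F0; apply/negP; rewrite negbK; apply/eqP.
      have sub0 : is_subspace [set (0 : V)].
        by split=> // a u u' -> ->; rewrite scaler0 addr0.
      rewrite FI in Fv; apply: (lspan_sub sub0 _ Fv) => e Ie.
      by case: nI; exists e.
    apply: contrapT => nE; have [v] := FT; apply; rewrite FI.
    have : lspan E v by rewrite spanE.
    apply: lspanS => e Ee; apply: contrapT => nIe; apply: nE.
    by exists e.
  - by move=> w fS e e' Ie Ie'; apply: (isoF w fS); rewrite FI; apply: lspan_mem.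
  - by move=> p Pp; rewrite -FI; apply: (flag_stabilizer_member flag Pp).
(* A flag containing at most [0] and [V] is stabilized by the whole group. *)
have [F [FFF F0 FT]] : exists F, [/\ FF F, exists2 v, F v & v != 0 & exists v, ~ F v].
  apply: contrapT => none; apply: proper => g Gg; split=> //.
  have gF F : FF F -> g @` F = F.
    move=> FFF; have [lg [g' gK g'K] _] := ind_group_finite_rank Gg.
    have [F0|/existsNP[v Fv]] := pselect (forall v, F v).
      apply/seteqP; split=> [v _|v _]; first exact: F0.
      by exists (g' v); rewrite ?g'K.
    have F0 u : F u -> u = 0.
      move=> Fu; apply/eqP; apply: contrapT => /negP u0; apply: none.
      by exists F; split=> //; [exists u | exists v].
    apply/seteqP; split=> [_ [u Fu <-]|u Fu].
      by rewrite (F0 u) // (lin0 lg); case: (sub F FFF).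
    by exists u => //; rewrite (F0 u) // (lin0 lg).
  apply/seteqP; split=> [_ [F FFF <-]|F FFF]; first by rewrite gF.
  by exists F => //; apply: gF.
case fS : (form_of S) dual => [w|] dual; last by exists F; split.
have [FFp Fpp] := dual F FFF.
have iso H : H `<=` perp w H -> forall w', Some w = Some w' ->
    forall u v, H u -> H v -> w' u v = 0.
  by move=> Hp _ [<-] u v Hu /Hp; apply.
have [FFp'|Fp'] := tot _ _ FFF FFp; first by exists F; split=> //; apply: iso.
exists (perp w F); split=> //.
- apply: contrapT => p0; have [v] := FT; apply; rewrite -Fpp => u pu.
  suff -> : u = 0 by rewrite linear0l.
  by apply/eqP; apply: contrapT => /negP u0; apply: p0; exists u.
- by have [v Fv] := FT; exists v => /Fp'.
- by apply: iso; rewrite Fpp.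
Qed.

End Parabolics.

Lemma infinite_of_distinct (T : eqType) (A : set T) :
  (forall N, exists x : 'I_N -> T, injective x /\ forall t, A (x t)) -> infinite_set A.
Proof.
move=> h /finite_seqP[s As]; have [x [inj_x Ax]] := h (size s).+1.
have : (size (map x (enum 'I_(size s).+1)) <= size s)%N.
  apply: uniq_leq_size => [|_ /mapP[t _ ->]]; first by rewrite map_inj_uniq ?enum_uniq.
  by have := Ax t; rewrite As.
by rewrite size_map size_enum_ord ltnn.
Qed.

(** The tuples of translates are required in finite families of every size, rather
    than in one infinite family, to accommodate those that stem from chains of
    subspaces of prescribed length. *)
Definition separated_translates (T J : Type) (G : set (T -> T)) (A : J -> set T) :=
  forall N, exists g : 'I_N -> J -> T -> T, (forall t i, G (g t i)) /\
    forall t t' h, G h ->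
      (forall i, h @` (g t i @` A i) = g t' i @` A i) -> t = t'.

Lemma separated_translates_sub (T : Type) (J J' : finType) (G : set (T -> T))
    (A : J' -> set T) (j : J -> J') : G id -> injective j ->
  separated_translates G (fun i => A (j i)) -> separated_translates G A.
Proof.
move=> Gid inj_j sep N; have [g [Gg gA]] := sep N.
exists (fun t i => if [pick c | j c == i] is Some c then g t c else id).
split=> [t i|t t' h Gh hg]; first by case: pickP.
apply: (gA t t' h Gh) => c; have := hg (j c).
by case: pickP => [c' /eqP/inj_j->|/(_ c)]; rewrite ?eqxx.
Qed.

Section OrbitCounting.
Variables (T : Type) (G : set (T -> T)) (l : nat) (P : 'I_l -> set (T -> T)).
Variable A : 'I_l -> set T.
Hypotheses (Gid : G id) (Pid : forall i, P i id).
Hypothesis PA : forall i p, P i p -> p @` A i = A i.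

(** Orbits are told apart by the positions of subspaces [A i] stable under
    the [P i]. *)
Lemma diag_orbits_infinite :
  separated_translates G A -> infinite_set (diag_orbits G P).
Proof.
move=> many; apply: infinite_of_distinct => N; have [g [Gg gA]] := many N.
exists (fun t => diag_orbit G (fun i => translate (g t i) (P i))); split; last first.
  move=> t; exists (fun i => translate (g t i) (P i)) => // i.
  by exists (g t i).
move=> t t' e.
have : diag_orbit G (fun i => translate (g t i) (P i))
    (fun i => translate (g t' i) (P i)).
  rewrite e; exists id => //; apply/funext => i.
  by apply/seteqP; split=> [_ [c Pc <-]|c Pc]; [ | exists c].
move=> [h Gh hE]; apply: (gA t t' h) => // i.
have : translate (g t' i) (P i) (h \o (g t i \o id)).
  by have /(congr1 (fun x => x i)) <- := hE; exists (g t i \o id) => //; exists id.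
move=> [p Pp pE]; rewrite -[in RHS](PA Pp) [RHS]image_comp pE.
by rewrite [LHS]image_comp.
Qed.

End OrbitCounting.

(** * Frames spanning the same space *)

Section TargetFrames.
Variables (K : fieldType) (V : lmodType K) (S : ind_data V).
Hypothesis vS : valid_data S.

Section Mix.
Variables (n : nat) (X : 'I_n * bool -> V) (Phi : 'I_n * bool -> V -> K^o).
Hypothesis fX : frame S X Phi.
Variables a b c d del : 'I_n -> K.

(** Each pair of the frame undergoes a linear substitution, with inverse
    determinant [del]. *)
Definition mix_vec (x : 'I_n * bool) : V :=
  let: (k, s) := x in
  if s then a k *: X (k, true) + b k *: X (k, false)
  else c k *: X (k, true) + d k *: X (k, false).

Definition mix_coord (x : 'I_n * bool) : V -> K^o :=
  let: (k, s) := x in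
  if s then fun v => del k * (d k * Phi (k, true) v - c k * Phi (k, false) v)
  else fun v => del k * (a k * Phi (k, false) v - b k * Phi (k, true) v).

Hypothesis det : forall k, del k * (a k * d k - b k * c k) = 1.

(** In characteristic other than two, for a symmetric form these conditions leave
    the diagonal and antidiagonal substitutions of each hyperbolic pair, for an
    alternating form all those of determinant one. *)
Lemma mix_frame :
  (forall w, form_of S = Some w -> forall k,
    [/\ del k * a k = a k, del k * d k = d k,
        del k * b k = - (swap_sign S * b k) & del k * c k = - (swap_sign S * c k)]) ->
  frame S mix_vec mix_coord /\ same_projection X mix_vec Phi mix_coord.
Proof.
move=> form; have [SPhi bX fPhi] := fX; split; last first.
  move=> v; rewrite (eq_bigr (fun x => Phi (x.1, x.2) v *: X (x.1, x.2))); last by case.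
  rewrite [RHS](eq_bigr (fun x => mix_coord (x.1, x.2) v *: mix_vec (x.1, x.2)));
    last by case.
  rewrite -(pair_bigA _ (fun k s => Phi (k, s) v *: X (k, s))) /=.
  rewrite -(pair_bigA _ (fun k s => mix_coord (k, s) v *: mix_vec (k, s))) /=.
  apply: eq_bigr => k _; rewrite !big_bool /= !scalerDr !scalerA addrACA -!scalerDl.
  by congr (_ *: _ + _ *: _); rewrite -[LHS]mul1r -(det k); ring.
split.
- have sS := predual_subspace vS; move=> [k []].
    rewrite (_ : mix_coord _ = (del k * d k) *: Phi (k, true)
      + (- (del k * c k)) *: Phi (k, false)); last first.
      by apply/funext => v; rewrite /= !fctE /GRing.scale /=; ring.
    by apply: subspaceD => //; apply: subspaceZ.
  rewrite (_ : mix_coord _ = (del k * a k) *: Phi (k, false)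
    + (- (del k * b k)) *: Phi (k, true)); last first.
    by apply/funext => v; rewrite /= !fctE /GRing.scale /=; ring.
  by apply: subspaceD => //; apply: subspaceZ.
- have lPhi x := frame_linear vS x fX.
  move=> [k s] [l r] /=; rewrite xpair_eqE.
  case: s; case: r => /=;
    rewrite !(linD (lPhi _)) !(linZ (lPhi _)) !bX !xpair_eqE /GRing.scale /= ?andbF;
    (have [<-|_] := eqVneq k l; last by rewrite /=; ring).
  + by rewrite /= [RHS]mulr1n -[RHS](det k); ring.
  + by rewrite /=; ring.
  + by rewrite /=; ring.
  + by rewrite /= [RHS]mulr1n -[RHS](det k); ring.
- move=> w fS k v; have [ea ed eb ec] := form w fS k; have [e1 e2] := fPhi w fS k v.
  rewrite /= e1 e2 linearDr linearDl !linearZr_LR !linearZl_LR /=.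
  rewrite (form_swap v (X (k, true)) vS fS) (form_swap (X (k, false)) v vS fS).
  by split; rewrite mulrBr !mulrA ?ed ?ec ?ea ?eb; ring.
Qed.

End Mix.

(** For an alternating form, exchanging the vectors of a hyperbolic pair requires
    a sign, which is put on the second one. *)
Lemma flip_frame n X Phi (flip : pred 'I_n) : frame S X Phi ->
  exists Y Psi, [/\ frame S Y Psi, same_projection X Y Phi Psi,
    forall k s, ~~ flip k -> Y (k, s) = X (k, s) /\ Psi (k, s) = Phi (k, s)
  & forall k v, flip k -> [/\ Y (k, true) = X (k, false),
      Psi (k, true) v = Phi (k, false) v
    & Psi (k, false) v = swap_sign S * Phi (k, true) v]].
Proof.
move=> fX; pose s := swap_sign S.
pose a k : K := if flip k then 0 else 1.
pose b k : K := if flip k then 1 else 0.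
pose c k : K := if flip k then s else 0.
pose del k : K := if flip k then - s else 1.
have ss := swap_signK S; rewrite -/s in ss.
have [|w fS k|fY XY] := @mix_frame n X Phi fX a b c a del.
- rewrite /a /b /c /del => k; case: ifP => _; last by ring.
  by rewrite -[RHS]ss; ring.
- rewrite /a /b /c /del -/s; case: ifP => _; split; ring.
exists (mix_vec X a b c a), (mix_coord Phi a b c a del); split=> //.
- move=> k r; rewrite /mix_vec /mix_coord /a /b /c /del => /negPf->.
  case: r; rewrite ?scale1r ?scale0r ?addr0 ?add0r; split=> //; apply/funext => v; ring.
- move=> k v; rewrite /mix_vec /mix_coord /a /b /c /del => ->.
  split; first by rewrite scale0r scale1r add0r.
    by rewrite -[RHS]mul1r -[X in _ = X * _]ss; ring.
  by rewrite /s; ring.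
Qed.

(** Replacing [e] by [e + t f] in the first pair, which keeps the pair hyperbolic
    only if the form is alternating. *)
Lemma shear_frame n (X : 'I_n.+1 * bool -> V) Phi (t : K) : frame S X Phi ->
  (forall w, form_of S = Some w -> swap_sign S = -1) ->
  exists Y Psi, [/\ frame S Y Psi, same_projection X Y Phi Psi,
    Y (ord0, true) = X (ord0, true) + t *: X (ord0, false)
  & forall v, Psi (ord0, false) v = Phi (ord0, false) v - t * Phi (ord0, true) v].
Proof.
move=> fX alt.
pose b (k : 'I_n.+1) : K := if k == ord0 then t else 0.
have [|w fS k|fY XY] := @mix_frame _ X Phi fX (fun=> 1) b (fun=> 0) (fun=> 1) (fun=> 1).
- by move=> k; ring.
- by rewrite (alt w fS); split; ring.
exists (mix_vec X (fun=> 1) b (fun=> 0) (fun=> 1)).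
exists (mix_coord Phi (fun=> 1) b (fun=> 0) (fun=> 1) (fun=> 1)).
split=> // [|v]; rewrite /= /b eqxx; first by rewrite scale1r.
by ring.
Qed.

(** The isotropic lines of the quadratic space spanned by a hyperbolic pair and
    a vector orthogonal to it form a conic, with affine part spanned by the
    [e - t^2 f + t (e' + f')]; the rest of the frame is adjusted to stay
    hyperbolic. *)
Section Siegel.
Variables (m : nat) (X : 'I_m.+1 * bool -> V) (Phi : 'I_m.+1 * bool -> V -> K^o).
Hypothesis fX : frame S X Phi.
Variable t : K.

Definition siegel_vec (x : 'I_m.+1 * bool) : V :=
  if x.1 == ord0 then
    if x.2 then X (ord0, true) - t ^+ 2 *: X (ord0, false)
                + t *: (X (ord_max, true) + X (ord_max, false))
    else X (ord0, false)
  else if x.1 == ord_max then X x - t *: X (ord0, false) else X x.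

Definition siegel_coord (x : 'I_m.+1 * bool) : V -> K^o := fun v =>
  if x.1 == ord0 then
    if x.2 then Phi (ord0, true) v
    else Phi (ord0, false) v - t ^+ 2 * Phi (ord0, true) v
         + t * (Phi (ord_max, true) v + Phi (ord_max, false) v)
  else if x.1 == ord_max then Phi x v - t * Phi (ord0, true) v else Phi x v.

Lemma siegel_frame : (0 < m)%N -> swap_sign S = 1 ->
  frame S siegel_vec siegel_coord /\ same_projection X siegel_vec Phi siegel_coord.
Proof.
move=> m0 sym; have [SPhi bX fPhi] := fX; have lPhi x := frame_linear vS x fX.
have m1 : (ord_max == ord0 :> 'I_m.+1) = false.
  by rewrite -val_eqE /=; case: (m) m0.
split; last first.
  move=> v; rewrite (eq_bigr (fun x => Phi (x.1, x.2) v *: X (x.1, x.2))); last by case.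
  rewrite [RHS](eq_bigr (fun x => siegel_coord (x.1, x.2) v *: siegel_vec (x.1, x.2)));
    last by case.
  rewrite -(pair_bigA _ (fun k s => Phi (k, s) v *: X (k, s))) /=.
  rewrite -(pair_bigA _ (fun k s => siegel_coord (k, s) v *: siegel_vec (k, s))) /=.
  rewrite (bigD1 ord0) // (bigD1 ord_max) /=; last by rewrite m1.
  rewrite [RHS](bigD1 ord0) // [in RHS](bigD1 ord_max) /=; last by rewrite m1.
  rewrite [X in _ + (_ + X)](_ : _ = \sum_(i < m.+1 | (i != ord0) && (i != ord_max))
      \sum_j siegel_coord (i, j) v *: siegel_vec (i, j)); last first.
    apply: eq_bigr => k /andP[k0 km]; apply: eq_bigr => s _.
    by rewrite /siegel_coord /siegel_vec /= (negPf k0) (negPf km).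
  rewrite !addrA; congr (_ + _).
  rewrite !big_bool /siegel_coord /siegel_vec /= m1 eqxx.
  set e := X (ord0, true); set f := X (ord0, false).
  set e' := X (ord_max, true); set f' := X (ord_max, false).
  (* Coordinates with respect to the two pairs concerned. *)
  pose L a b c d : V := a *: e + b *: f + (c *: e' + d *: f').
  have LD a b c d a' b' c' d' :
      L a b c d + L a' b' c' d' = L (a + a') (b + b') (c + c') (d + d').
    by rewrite /L !scalerDl addrACA [a *: e + _ + _]addrACA [c *: e' + _ + _]addrACA.
  have LZ k a b c d : k *: L a b c d = L (k * a) (k * b) (k * c) (k * d).
    by rewrite /L !scalerDr !scalerA.
  have ee : e - t ^+ 2 *: f + t *: (e' + f') = L 1 (- t ^+ 2) t t.
    by rewrite /L scale1r scaleNr scalerDr.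
  have ef : f = L 0 1 0 0 by rewrite /L !scale0r scale1r add0r !addr0.
  have ee' : e' - t *: f = L 0 (- t) 1 0.
    by rewrite /L !scale0r scale1r scaleNr add0r addr0 addrC.
  have ef' : f' - t *: f = L 0 (- t) 0 1.
    by rewrite /L !scale0r scale1r scaleNr !add0r addrC.
  rewrite ee ee' ef' [X in _ = _ + _ *: X + _]ef !LZ !LD.
  by rewrite -/(L _ _ _ _); congr L; ring.
split.
- have sS := predual_subspace vS; move=> [k s].
  have [k0|k0] := eqVneq k ord0.
    subst k; case: s; first exact: SPhi.
    rewrite (_ : siegel_coord _ = Phi (ord0, false) - t ^+ 2 *: Phi (ord0, true)
        + t *: (Phi (ord_max, true) + Phi (ord_max, false))) //.
    apply: subspaceD => //; first by apply: subspaceB => //; apply: subspaceZ.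
    by apply: subspaceZ => //; apply: subspaceD.
  have [km|km] := eqVneq k ord_max; last first.
    rewrite (_ : siegel_coord _ = Phi (k, s)) //; apply/funext => v.
    by rewrite /siegel_coord /= (negPf k0) (negPf km).
  rewrite (_ : siegel_coord _ = Phi (k, s) - t *: Phi (ord0, true)).
    by apply: subspaceB => //; apply: subspaceZ.
  by apply/funext => v; rewrite /siegel_coord /= (negPf k0) km eqxx.
- have m1' : (ord0 == ord_max :> 'I_m.+1) = false by rewrite eq_sym m1.
  move=> [k s] [l r] /=; rewrite /siegel_coord /siegel_vec /=.
  have [->|k0] := eqVneq k ord0; last have [->|km] := eqVneq k ord_max;
  (have [->|l0] := eqVneq l ord0; last have [->|lm] := eqVneq l ord_max);
  case: s; case: r => /=;
  rewrite ?(linD (lPhi _)) ?(linN (lPhi _)) ?(linZ (lPhi _)) ?(linD (lPhi _)) !bX;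
  rewrite !xpair_eqE ?eqxx ?m1 ?m1' ?(negPf k0) ?(negPf km) ?andbF ?andbT /=;
  rewrite ?[ord0 == l]eq_sym ?[ord_max == l]eq_sym ?(negPf l0) ?(negPf lm) /=;
  rewrite /GRing.scale /=; try ring.
- move=> w fS k v; rewrite /siegel_coord /siegel_vec /=.
  have e1 i := (fPhi w fS i v).1; have e2 i := (fPhi w fS i v).2.
  have e3 i : w (X (i, false)) v = w v (X (i, false)).
    by rewrite (form_swap _ _ vS fS) sym mul1r.
  have [_|k0] := eqVneq k ord0.
    split; first exact: e1.
    rewrite !linearDl linearNl !linearZl_LR linearDl /= !e3 !e1 !e2.
    by rewrite [w v _ + _]addrC.
  have [->|km] := eqVneq k ord_max; last by rewrite e1 e2.
  rewrite !e1 !e2 linearDr linearDl linearNr linearNl linearZr_LR linearZl_LR /= e3.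
  by split.
Qed.

End Siegel.
End TargetFrames.

(** * Infinitely many positions of subspaces *)

Section Positions.
Variables (K : fieldType) (V : lmodType K) (S : ind_data V) (E : set V).
Hypotheses (vS : valid_data S) (aE : admissible S E) (infE : infinite_set E).

Lemma ind_group_linear g : ind_group S g -> linear g.
Proof. by case/ind_group_finite_rank. Qed.

Lemma ind_group_inj g : ind_group S g -> injective g.
Proof. by case/ind_group_finite_rank => _ /bij_inj. Qed.

Lemma ind_group_surj g v : ind_group S g -> exists u, g u = v.
Proof. by case/ind_group_finite_rank => _ [g' _ g'K] _; exists (g' v). Qed.

(** ** Two subspaces, neither small nor large *)

Section TwoSubspaces.
Variable A : bool -> set V.
Hypothesis sA : forall b, is_subspace (A b).
Hypothesis split_frames : forall n b, exists X Phi, @frame K V S n X Phi /\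
  forall k, A b (X (k, true)) /\ forall v, A b v -> Phi (k, false) v = 0.

(** The [t]-th position makes the two subspaces share the first [t] vectors of a
    frame of length [N], so that the intersections form a strictly increasing
    chain; a finite-rank perturbation of the identity cannot carry one member of
    such a chain to another. *)
Lemma separated_pair : separated_translates (ind_group S) A.
Proof.
move=> N.
have /choice[X /choice[Phi fA]] := split_frames N.
have fX b : frame S (X b) (Phi b) by case: (fA b).
have XA b k : A b (X b (k, true)) by have [_ /(_ k)[]] := fA b.
have PhiA b k v : A b v -> Phi b (k, false) v = 0.
  by have [_ /(_ k)[_]] := fA b; apply.
have [X0 [Phi0 [fX0 orth]]] := fresh_frame vS aE infE fX.
have /choice[Y /choice[Psi YP]] := fun t : 'I_N =>
  flip_frame vS (fun k : 'I_N => t <= k)%N fX0.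
have fY t : frame S (Y t) (Psi t) by case: (YP t).
have XY t : same_projection X0 (Y t) Phi0 (Psi t) by case: (YP t).
pose g1 := place (X true) X0 X0 (Phi true) Phi0.
pose g2 t := place (X false) X0 (Y t) (Phi false) Phi0.
have Gg1 : ind_group S g1 by apply: place_ind_group (orth true) _ => //.
have Gg2 t : ind_group S (g2 t) by apply: place_ind_group (orth false) (XY t) => //.
pose C1 := g1 @` A true; pose C2 t := g2 t @` A false.
exists (fun t b => if b then g1 else g2 t); split=> [t []//|t t' h Gh hC].
have hC1 : h @` C1 = C1 := hC true.
have {hC} hC2 : h @` C2 t = C2 t' := hC false.
have sC1 : is_subspace C1 by apply: subspace_image (ind_group_linear Gg1) (sA _).
have sC2 r : is_subspace (C2 r).
  exact: subspace_image (ind_group_linear (Gg2 r)) (sA _).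
have C1vanish x k : C1 x -> Phi0 (k, false) x = 0.
  move=> [y Ay <-]; rewrite (place_coord vS (fX _) fX0 (orth true)) //.
  exact: PhiA.
have C2coord r y a : Psi r a (g2 r y) = Phi false a y.
  exact: (place_coord vS (fX _) (fY r) (orth false) (XY r)).
have C2vec (r k : 'I_N) : (k < r)%N -> C2 r (X0 (k, true)).
  move=> kr; exists (X false (k, true)); first exact: XA.
  rewrite /g2 (place_vec _ (fX _) fX0 (orth _)) //; have [_ _ /(_ k true) [] //] := YP r.
  by rewrite -ltnNge.
(* A vector of the smaller intersection is a combination of shared frame vectors and
   of a vector [g2 r (y - y1)] that does not depend on [r]. *)
have mono (r r' : 'I_N) : (r <= r')%N -> C1 `&` C2 r `<=` C1 `&` C2 r'.
  move=> rr' x [C1x C2x]; split=> //; have [y Ay xy] := C2x.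
  pose y1 := \sum_k Phi false (k, true) y *: X false (k, true).
  have Ay1 : A false y1.
    by apply: subspace_sum => [|k _]; [exact: sA | apply: subspaceZ; [exact: sA | exact: XA]].
  have y0 a : Phi false a (y - y1) = 0.
    have lPhi := frame_linear vS a (fX false); have [_ bX _] := fX false.
    rewrite (linB lPhi) (lin_sum lPhi); case: a lPhi => k [] lPhi.
      rewrite (bigD1 k) //= big1 => [|i ik].
        by rewrite (linZ lPhi) bX eqxx addr0 [_ *: _]mulr1 subrr.
      by rewrite (linZ lPhi) bX xpair_eqE eq_sym (negPf ik) scaler0.
    rewrite PhiA // big1 ?subrr // => i _.
    by rewrite (linZ lPhi) bX xpair_eqE andbF scaler0.
  rewrite -xy -(subrK y1 y) addrC (linD (ind_group_linear (Gg2 r))).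
  apply: subspaceD => //; last first.
    have -> : g2 r (y - y1) = g2 r' (y - y1) by apply: place_ker.
    exists (y - y1) => //.
    by apply: subspaceB => //; apply: sA.
  rewrite (lin_sum (ind_group_linear (Gg2 r))); apply: subspace_sum => // k _.
  rewrite (linZ (ind_group_linear (Gg2 r))).
  have [kr|rk] := ltnP k r.
    apply: subspaceZ => //; rewrite [g2 r _](place_vec _ (fX _) fX0 (orth _)).
    have rk : ~~ (r <= k)%N by rewrite -ltnNge.
    have [_ _ /(_ k true rk)[-> _] _] := YP r.
    by apply: C2vec; apply: leq_trans kr rr'.
  have [_ _ _ /(_ k x rk)[_ ek _]] := YP r.
  by rewrite -(C2coord r) xy ek C1vanish // scale0r; case: (sC2 r').
have strict (r r' : 'I_N) : (r < r')%N -> exists2 z, (C1 `&` C2 r') z & ~ C2 r z.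
  move=> rr'; exists (X0 (r, true)).
    split; last exact: C2vec.
    by exists (X true (r, true)); rewrite // [g1 _](place_vec _ (fX _) fX0 (orth _)).
  move=> [y Ay xy]; have [_ _ _ /(_ r (X0 (r, true)) (leqnn r))[_ _]] := YP r.
  rewrite -[X in Psi r _ X]xy C2coord PhiA //; have [_ -> _] := fX0.
  rewrite eqxx mulr1 => s0; have := swap_signK S.
  by rewrite -s0 mulr0 => /esym/eqP; rewrite oner_eq0.
have hC : h @` (C1 `&` C2 t) = C1 `&` C2 t'.
  apply/seteqP; split=> [_ [x [C1x C2x] <-]|x].
    by split; [rewrite -hC1 | rewrite -hC2]; exists x.
  rewrite -[in X in X -> _]hC1 -hC2 => -[[y C1y <-] [z C2z /(ind_group_inj Gh) zy]].
  by exists y => //; split=> //; rewrite -zy.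
have sC : is_subspace (C1 `&` C2 t) by apply: subspaceI.
case: (ltngtP t t') => [lt_t|lt_t|]; last exact: val_inj.
- have [z Zz] := strict _ _ lt_t; case.
  suff e : C1 `&` C2 t = C1 `&` C2 t' by rewrite -e in Zz; case: Zz.
  by rewrite -hC (ind_group_image_sup Gh sC) // hC; apply: mono; apply: ltnW.
- have [z Zz] := strict _ _ lt_t; case.
  suff e : C1 `&` C2 t = C1 `&` C2 t' by rewrite e in Zz; case: Zz.
  by rewrite -hC (ind_group_image_sub Gh sC) // hC; apply: mono; apply: ltnW.
Qed.

End TwoSubspaces.
End Positions.

Section FourSubspaces.
Variables (K : fieldType) (V : lmodType K) (S : ind_data V) (E : set V).
Hypotheses (vS : valid_data S) (aE : admissible S E) (infE : infinite_set E).
Hypothesis charK : injective (fun n => n%:R : K).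
Variables (A : 'I_4 -> set V) (m : nat).
Variables (X : 'I_4 -> 'I_m.+1 * bool -> V) (Phi : 'I_4 -> 'I_m.+1 * bool -> V -> K^o).
Hypothesis sA : forall j, is_subspace (A j).
Hypothesis fX : forall j, frame S (X j) (Phi j).

Let i0 : 'I_4 := @Ordinal 4 0 isT.
Let i1 : 'I_4 := @Ordinal 4 1 isT.
Let i2 : 'I_4 := @Ordinal 4 2 isT.
Let i3 : 'I_4 := @Ordinal 4 3 isT.

Hypothesis XA : forall j, A j (X j (ord0, true)).

(** In the plane of the first pair of a common frame the four subspaces cut the
    lines of [e], [f], [e + f], [e + t f]. An element [h] carrying one position to
    another one multiplies these four vectors by one and the same scalar, up to
    vectors of a complement of the plane. Unless the scalar vanishes, the
    parameters agree; the last hypothesis excludes that it vanishes, by putting the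
    part of the first subspace lying in the complement inside the second one. *)
Lemma separated_lines :
  (forall w, form_of S = Some w -> swap_sign S = -1) ->
  (forall j v, A j v -> Phi j (ord0, false) v = 0) ->
  (forall v, A i0 v -> v = \sum_k Phi i0 (k, true) v *: X i0 (k, true)) /\
    (forall k, A i1 (X i1 (k, true))) \/
  (forall k v, A i0 v -> Phi i0 (k, false) v = 0) /\
    (forall v, (forall k, Phi i1 (k, false) v = 0) -> A i1 v) ->
  separated_translates (ind_group S) A.
Proof.
move=> alt PhiA contained N.
have [X0 [Phi0 [fX0 orth]]] := fresh_frame vS aE infE fX.
have [Y1 [Psi1 [fY1 XY1 Y1E flipE]]] := flip_frame vS (pred1 ord0) fX0.
have [Y2 [Psi2 [fY2 XY2 Y2E Psi2E]]] := shear_frame vS 1 fX0 alt.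
have /choice[Y3 /choice[Psi3 YP3]] := fun t : 'I_N => shear_frame vS t%:R fX0 alt.
pose Y t (j : 'I_4) := nth X0 [:: X0; Y1; Y2; Y3 t] j.
pose Psi t (j : 'I_4) := nth Phi0 [:: Phi0; Psi1; Psi2; Psi3 t] j.
have fY t j : frame S (Y t j) (Psi t j).
  by have [? _ _ _] := YP3 t; case: j => [[|[|[|[|//]]]] lt].
have XY t j : same_projection X0 (Y t j) Phi0 (Psi t j).
  by have [_ ? _ _] := YP3 t; case: j => [[|[|[|[|//]]]] lt].
pose g t j := place (X j) X0 (Y t j) (Phi j) Phi0.
have Gg t j : ind_group S (g t j) by apply: place_ind_group (orth j) (XY t j).
exists g; split=> // t t' h Gh hC.
have lh := ind_group_linear Gh.
pose C r j := g r j @` A j.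
have Ccoord r j v a : Psi r j a (g r j v) = Phi j a v.
  exact: (place_coord vS (fX j) (fY r j) (orth j) (XY r j)).
have CY r j a : A j (X j a) -> C r j (Y r j a).
  move=> AX; exists (X j a) => //.
  exact: (place_vec _ (fX j) fX0 (orth j)).
have Cvanish r j x : C r j x -> Psi r j (ord0, false) x = 0.
  by move=> [v Av <-]; rewrite Ccoord PhiA.
pose v j := Y t j (ord0, true).
have hv j : C t' j (h (v j)).
  by rewrite /C -hC; exists (v j) => //; apply: CY.
have lPhi0 a := frame_linear vS a fX0.
pose phi := Phi0 (ord0, true); pose psi := Phi0 (ord0, false).
have lphi : linear phi := lPhi0 _; have lpsi : linear psi := lPhi0 _.
have [e1v _ _] := flipE ord0 0 (eqxx _).
have ss0 : swap_sign S != 0.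
  by apply/eqP => s0; have := swap_signK S; rewrite s0 mul0r => /esym/eqP; rewrite oner_eq0.
(* Each translate satisfies the equation of its line in the plane. *)
have E0 : psi (h (v i0)) = 0 by exact: (Cvanish t' i0).
have E1 x r : C r i1 x -> phi x = 0.
  move=> /Cvanish; rewrite /Psi /=; have [_ _ ->] := flipE ord0 x (eqxx _).
  by move/eqP; rewrite mulf_eq0 (negPf ss0) => /eqP.
have E2 : psi (h (v i2)) = phi (h (v i2)).
  have := Cvanish t' i2 _ (hv i2); rewrite /Psi /= Psi2E mul1r => /eqP.
  by rewrite subr_eq0 => /eqP.
have E3 : psi (h (v i3)) = t'%:R * phi (h (v i3)).
  have := Cvanish t' i3 _ (hv i3); rewrite /Psi /=.
  by have [_ _ _ ->] := YP3 t' => /eqP; rewrite subr_eq0 => /eqP.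
have v2E : v i2 = v i0 + v i1 by rewrite /v /Y /= Y2E e1v scale1r.
have v3E : v i3 = v i0 + t%:R *: v i1.
  by rewrite /v /Y /= e1v; have [_ _ -> _] := YP3 t.
rewrite v2E (linD lh) (linD lphi) (linD lpsi) E0 (E1 _ t' (hv i1)) add0r addr0 in E2.
rewrite v3E (linD lh) (linZ lh) (linD lphi) (linD lpsi) (linZ lphi) (linZ lpsi) in E3.
rewrite E0 (E1 _ t' (hv i1)) scaler0 addr0 add0r E2 in E3.
have [phi0|phi_neq0] := eqVneq (phi (h (v i0))) 0; last first.
  by apply/val_inj/charK; apply: (mulIf phi_neq0).
(* If the scalar vanishes, [h] sends [v i0] into the complement of the plane, hence
   into the second subspace, although [v i0] is not in that subspace. *)
suff C1 : C t' i1 (h (v i0)).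
  move: C1; rewrite /C -hC => -[x Cx /(ind_group_inj Gh) xv].
  have := E1 x t Cx; rewrite xv /v /Y /phi /=; have [_ -> _] := fX0.
  by rewrite eqxx => /eqP; rewrite oner_eq0.
have [[spanA0 XA1]|[PhiA0 kerA1]] := contained.
  have [x Ax xE] := hv i0; rewrite -xE (spanA0 x Ax).
  rewrite (lin_sum (ind_group_linear (Gg t' i0))); apply: subspace_sum => [|k _].
    exact: subspace_image (ind_group_linear (Gg t' i1)) (sA i1).
  rewrite (linZ (ind_group_linear (Gg t' i0))) -(Ccoord t' i0) xE.
  have sC1 : is_subspace (C t' i1).
    exact: subspace_image (ind_group_linear (Gg t' i1)) (sA i1).
  have [->|k0] := eqVneq k ord0; first by rewrite [Psi _ _ _ _]phi0 scale0r; case: sC1.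
  apply: subspaceZ => //; rewrite [g _ _ _](place_vec _ (fX _) fX0 (orth _)).
  have -> : Y t' i0 (k, true) = Y t' i1 (k, true) by rewrite /Y /= (Y1E k true k0).1.
  exact: CY.
have [x Ax xE] := hv i0.
have [y yE] := ind_group_surj (h (v i0)) (Gg t' i1).
exists y => //; apply: kerA1 => k; rewrite -(Ccoord t' i1) yE.
have [->|k0] := eqVneq k ord0.
  rewrite /Psi /=; have [_ _ ->] := flipE ord0 (h (v i0)) (eqxx _).
  by rewrite [Phi0 _ _]phi0 mulr0.
by rewrite [Psi _ _ _](Y1E k false k0).2 -xE [LHS](Ccoord t' i0) PhiA0.
Qed.

(** Here the four subspaces cut lines of a conic inside the nondegenerate
    three-dimensional space spanned by [e], [f] and [e' + f'], the last three
    subspaces being sums of such lines and of subspaces of one isotropic space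
    orthogonal to everything in sight. An element carrying one position to another
    multiplies the last three vectors on the conic by scalars, up to that isotropic
    space; invariance of the form gives relations between the scalars, and the
    linear dependence of the four vectors then determines the parameter. *)
Lemma separated_conic w : form_of S = Some w -> swap_sign S = 1 -> (0 < m)%N ->
  (forall v, A i0 v -> Phi i0 (ord_max, false) v = 0) ->
  (forall j v, j != i0 -> A j v ->
     v = \sum_(k < m.+1 | (k < m)%N) Phi j (k, true) v *: X j (k, true)) ->
  separated_translates (ind_group S) A.
Proof.
move=> fS sym m0 PhiA0 spanA N.
have [X0 [Phi0 [fX0 orth]]] := fresh_frame vS aE infE fX.
have [Y1 [Psi1 [fY1 XY1 Y1E flipE]]] := flip_frame vS (pred1 ord0) fX0.
pose Y t (j : 'I_4) :=
  nth X0 [:: X0; Y1; siegel_vec X0 1; siegel_vec X0 t%:R] j.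
pose Psi t (j : 'I_4) :=
  nth Phi0 [:: Phi0; Psi1; siegel_coord Phi0 1; siegel_coord Phi0 t%:R] j.
have siegel c := siegel_frame vS fX0 c m0 sym.
have fY t j : frame S (Y t j) (Psi t j).
  by case: j => [[|[|[|[|//]]]] lt] //; [case: (siegel 1) | case: (siegel t%:R)].
have XY t j : same_projection X0 (Y t j) Phi0 (Psi t j).
  by case: j => [[|[|[|[|//]]]] lt] //; [case: (siegel 1) | case: (siegel t%:R)].
pose g t j := place (X j) X0 (Y t j) (Phi j) Phi0.
have Gg t j : ind_group S (g t j) by apply: place_ind_group (orth j) (XY t j).
exists (fun t => g t); split=> // t t' h Gh hC.
have lh := ind_group_linear Gh.
have wh : forall u v, w (h u) (h v) = w u v by have [_] := Gh; rewrite fS.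
pose C r j := g r j @` A j.
have Ccoord r j v a : Psi r j a (g r j v) = Phi j a v.
  exact: (place_coord vS (fX j) (fY r j) (orth j) (XY r j)).
pose v (r : nat) j := Y r j (ord0, true).
have hv j : C t' j (h (v t j)).
  rewrite /C -hC; exists (v t j) => //; exists (X j (ord0, true)) => //.
  exact: (place_vec _ (fX j) fX0 (orth j)).
have lPhi0 a := frame_linear vS a fX0; have [_ bX0 _] := fX0.
pose D := [set x | exists k : 'I_m.+1, [/\ k != ord0, (k < m)%N & x = X0 (k, true)]].
have YD r j (k : 'I_m.+1) : k != ord0 -> (k < m)%N -> Y r j (k, true) = X0 (k, true).
  move=> k0 km; have km' : k != ord_max by apply: contraTneq km => ->; rewrite ltnn.
  case: j => [[|[|[|[|//]]]] lt]; rewrite /Y /= ?(Y1E k true k0).1 //;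
  by rewrite /siegel_vec /= (negPf k0) (negPf km').
have decomp j : j != i0 -> exists c, exists2 d, lspan D d &
    h (v t j) = c *: v t' j + d.
  move=> j0; have [x Ax xE] := hv j; pose lg := ind_group_linear (Gg t' j).
  exists (Phi j (ord0, true) x), (h (v t j) - Phi j (ord0, true) x *: v t' j);
    last by rewrite addrC subrK.
  rewrite -xE {1}(spanA j x j0 Ax) (lin_sum lg) (bigD1 ord0) //= (linZ lg).
  rewrite [g _ _ _](place_vec _ (fX _) fX0 (orth _)) /v addrAC subrr add0r.
  apply: subspace_sum => [|k /andP[km k0]]; first exact: lspan_subspace.
  rewrite (linZ lg) [g _ _ _](place_vec _ (fX _) fX0 (orth _)) YD //.
  by apply: subspaceZ; [exact: lspan_subspace | apply: lspan_mem; exists k].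
have Dvanish k d : lspan D d -> Phi0 (k, false) d = 0.
  move=> [s [a [sD ->]]]; rewrite (lin_sum (lPhi0 _)) big_seq big1 // => x /sD[i [_ _ ->]].
  by rewrite (linZ (lPhi0 _)) bX0 xpair_eqE andbF scaler0.
pose perpD x := forall k : 'I_m.+1, k != ord0 -> (k < m)%N -> Phi0 (k, false) x = 0.
have wD d x : lspan D d -> perpD x -> w d x = 0.
  move=> [s [a [sD ->]]] px; rewrite linear_sumlz big_seq big1 // => y /sD[i [i1' im ->]].
  by rewrite linearZl_LR (frame_formE vS _ _ _ fX0 fS) /= px // !mulr0.
have perpv r j : perpD (v r j).
  move=> k k0 km; have km' : (ord_max == k) = false.
    by apply: contraTF km => /eqP <-; rewrite ltnn.
  have k0' : (ord0 == k) = false by rewrite eq_sym (negPf k0).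
  rewrite /v /Y; case: j => [[|[|[|[|//]]]] lt] /=.
  - by rewrite bX0 xpair_eqE andbF.
  - have [-> _ _] := flipE ord0 0 (eqxx _).
    by rewrite bX0 xpair_eqE eq_sym k0'.
  - rewrite /siegel_vec /= !(linD (lPhi0 _)) (linN (lPhi0 _)) !(linZ (lPhi0 _)).
    rewrite (linD (lPhi0 _)) !bX0 !xpair_eqE !(eq_sym k) k0' km' ?andbF /=.
    by rewrite /GRing.scale /=; ring.
  - rewrite /siegel_vec /= !(linD (lPhi0 _)) (linN (lPhi0 _)) !(linZ (lPhi0 _)).
    rewrite (linD (lPhi0 _)) !bX0 !xpair_eqE !(eq_sym k) k0' km' ?andbF /=.
    by rewrite /GRing.scale /=; ring.
(* The vectors of [D] are orthogonal to [D] and to the [v r j], so they do not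
   contribute to the Gram matrix. *)
have gram j j' c c' d d' : lspan D d -> lspan D d' ->
    w (c *: v t' j + d) (c' *: v t' j' + d') = c * c' * w (v t' j) (v t' j').
  move=> Dd Dd'; rewrite linearDl !linearDr !linearZl_LR !linearZr_LR /=.
  rewrite (wD d) // (wD d d') //; last by move=> k _ _; apply: Dvanish.
  by rewrite (form_swap _ d' vS fS) (wD d') // !mulr0 !addr0 mulrA.
have [[c1 [d1 Dd1 y1E]] [c2 [d2 Dd2 y2E]] [c3 [d3 Dd3 y3E]]] :
  [/\ exists c, exists2 d, lspan D d & h (v t i1) = c *: v t' i1 + d,
      exists c, exists2 d, lspan D d & h (v t i2) = c *: v t' i2 + d
    & exists c, exists2 d, lspan D d & h (v t i3) = c *: v t' i3 + d].
  by split; apply: decomp.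
have m1 : (ord_max == ord0 :> 'I_m.+1) = false by rewrite -val_eqE /=; case: (m) m0.
have m1' : (ord0 == ord_max :> 'I_m.+1) = false by rewrite eq_sym.
have v1E r : v r i1 = X0 (ord0, false).
  by rewrite /v /Y /=; have [-> _ _] := flipE ord0 0 (eqxx _).
have v2E r : v r i2 = siegel_vec X0 1 (ord0, true) by [].
have v3E r : v r i3 = siegel_vec X0 r%:R (ord0, true) by [].
have w1 c : w (X0 (ord0, false)) (siegel_vec X0 c (ord0, true)) = 1.
  rewrite (frame_formE vS _ _ _ fX0 fS) /= sym mul1r /siegel_vec /=.
  rewrite !(linD (lPhi0 _)) (linN (lPhi0 _)) !(linZ (lPhi0 _)) (linD (lPhi0 _)).
  by rewrite !bX0 !xpair_eqE m1' /= /GRing.scale /=; ring.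
have c12 : c1 * c2 = 1.
  by have := wh (v t i1) (v t i2); rewrite y1E y2E gram // !v1E !v2E !w1 mulr1.
have c13 : c1 * c3 = 1.
  by have := wh (v t i1) (v t i3); rewrite y1E y3E gram // !v1E !v3E !w1 mulr1.
have c1_neq0 : c1 != 0 by apply: contra_eq_neq c12 => ->; rewrite mul0r eq_sym oner_eq0.
have c23 : c3 = c2 by apply: (mulfI c1_neq0); rewrite c12.
have c2_neq0 : c2 != 0 by apply: contra_eq_neq c12 => ->; rewrite mulr0 eq_sym oner_eq0.
pose theta := Phi0 (ord_max, false); have ltheta : linear theta := lPhi0 _.
have theta0 : theta (h (v t i0)) = 0.
  by have [x Ax <-] := hv i0; rewrite [LHS](Ccoord t' i0) PhiA0.
have thetav c : theta (siegel_vec X0 c (ord0, true)) = c.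
  rewrite /theta /siegel_vec /= !(linD (lPhi0 _)) (linN (lPhi0 _)) !(linZ (lPhi0 _)).
  rewrite (linD (lPhi0 _)) !bX0 !xpair_eqE !eqxx m1 /= /GRing.scale /=.
  by ring.
(* Where the first subspace enters: [theta] vanishes on its translates, so that
   applying [theta] to the image of this relation compares [t] with [t']. *)
have dep : v t i3 = t%:R *: v t i2 + (1 - t%:R) *: v t i0 + ((1 - t%:R) * t%:R) *: v t i1.
  rewrite v1E v2E v3E /v /Y /siegel_vec /= expr1n !scale1r.
  set e := X0 (ord0, true); set f := X0 (ord0, false).
  set e' := X0 (ord_max, true) + X0 (ord_max, false).
  pose L a b c : V := a *: e + b *: f + c *: e'.
  have LD a b c a' b' c' : L a b c + L a' b' c' = L (a + a') (b + b') (c + c').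
    by rewrite /L !scalerDl addrACA [a *: e + _ + _]addrACA.
  have LZ k a b c : k *: L a b c = L (k * a) (k * b) (k * c).
    by rewrite /L !scalerDr !scalerA.
  have -> : e - f + e' = L 1 (- 1) 1 by rewrite /L scaleN1r !scale1r.
  rewrite (_ : e - _ + _ = L 1 (- t%:R ^+ 2) t%:R); last by rewrite /L scale1r scaleNr.
  rewrite LZ.
  have -> : (1 - t%:R) *: e = L (1 - t%:R) 0 0 by rewrite /L !scale0r !addr0.
  have -> : ((1 - t%:R) * t%:R) *: f = L 0 ((1 - t%:R) * t%:R) 0.
    by rewrite /L !scale0r add0r addr0.
  by rewrite !LD; congr L; ring.
have theta_h a b c x y z : theta (h (a *: x + b *: y + c *: z)) =
    a * theta (h x) + b * theta (h y) + c * theta (h z).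
  by rewrite !(linD lh) !(linZ lh) !(linD ltheta) !(linZ ltheta).
have theta_y1 : theta (h (v t i1)) = 0.
  rewrite y1E (linD ltheta) (linZ ltheta) [theta d1]Dvanish // v1E /theta bX0.
  by rewrite xpair_eqE m1 /= scaler0 addr0.
have : theta (h (v t i3)) = t%:R * theta (h (v t i2)).
  by rewrite dep theta_h theta0 theta_y1 !mulr0 !addr0.
rewrite y3E y2E !(linD ltheta) !(linZ ltheta) [theta d2]Dvanish // [theta d3]Dvanish // !addr0.
rewrite v3E v2E !thetav c23 [_ *: _]mulrC [_ *: _]mulr1 => e.
by apply/val_inj/charK/esym; apply: (mulIf c2_neq0).
Qed.

End FourSubspaces.

(** * The theorem *)

Lemma injection_through (l : nat) (r : 'I_4) (p : 'I_l) : (4 <= l)%N ->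
  exists j : 'I_4 -> 'I_l, injective j /\ j r = p.
Proof.
move=> hl; pose j0 := widen_ord hl.
(* The transposition of [p] and [j0 r]. *)
pose f x := if x == p then j0 r else if x == j0 r then p else x.
have fK : involutive f.
  move=> x; rewrite /f; have [->|xp] := eqVneq x p.
    by have [->|] := eqVneq (j0 r) p; rewrite ?eqxx.
  have [->|xr] := eqVneq x (j0 r); first by rewrite eqxx.
  by rewrite (negPf xp) (negPf xr).
exists (f \o j0); split; last by rewrite /f /= eqxx; case: eqP.
apply: inj_comp; first exact: can_inj fK.
by move=> x y /(congr1 val) /= e; apply: val_inj.
Qed.

Section Configuration.
Variables (K : fieldType) (V : lmodType K) (S : ind_data V).
Hypothesis vS : valid_data S.
Hypothesis charK : injective (fun n => n%:R : K).
Variables (l : nat) (E I : 'I_l -> set V).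
Hypothesis hl : (4 <= l)%N.
Hypothesis aE : forall i, admissible S (E i).
Hypothesis infE : forall i, infinite_set (E i).
Hypothesis IE : forall i, I i `<=` E i.
Hypothesis inI : forall i, exists e, I i e.
Hypothesis outI : forall i, exists2 f, E i f & ~ I i f.
Hypothesis isoI : forall i w, form_of S = Some w ->
  forall e e', I i e -> I i e' -> w e e' = 0.

Let A i := lspan (I i).
Let sA i : is_subspace (A i). Proof. exact: lspan_subspace. Qed.

Lemma finite_uniq_seq (F : set V) : finite_set F ->
  exists s, uniq s /\ F = [set` s].
Proof.
move=> /finite_seqP[s ->]; exists (undup s); split; first exact: undup_uniq.
by apply/seteqP; split=> x /=; rewrite mem_undup.
Qed.

(** Either a set is infinite or it has at least as many elements as the smallest
    finite one. *)
Lemma uniq_seq_of_size (F : 'I_l -> set V) p s :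
  uniq s -> F p = [set` s] ->
  (forall i r, uniq r -> F i = [set` r] -> (size s <= size r)%N) ->
  forall i, exists t, [/\ uniq t, [set` t] `<=` F i, size t = size s
    & i = p -> F i `<=` [set` t]].
Proof.
move=> us Fs min i; have [->|ip] := eqVneq i p.
  by exists s; rewrite Fs; split=> // _ x.
have [/finite_uniq_seq[r [ur Fr]]|infF] := pselect (finite_set (F i)).
  exists (take (size s) r); split.
  - exact: take_uniq.
  - by rewrite Fr => x /= /mem_take.
  - by rewrite size_takel // (min i).
  - by move=> ip'; rewrite ip' eqxx in ip.
have [t [st ut tF _]] := infinite_uniq_extend [::] (size s) infF.
by exists t; split=> // ip'; rewrite ip' eqxx in ip.
Qed.

Lemma smallest_finite (F : 'I_l -> set V) : (exists i, finite_set (F i)) ->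
  exists p s, [/\ uniq s, F p = [set` s]
    & forall i r, uniq r -> F i = [set` r] -> (size s <= size r)%N].
Proof.
move=> [i /finite_uniq_seq[r [ur Fr]]].
pose Q n := `[< exists p s, [/\ uniq s, F p = [set` s] & size s = n] >].
have exQ : exists n, Q n by exists (size r); apply/asboolP; exists i, r.
case: (ex_minnP exQ) => n /asboolP[p [s [us Fs sn]]] min.
exists p, s; split=> // i' r' ur' Fr'; rewrite sn; apply: min.
by apply/asboolP; exists i', r'.
Qed.

Lemma separated_two i i' : i != i' -> infinite_set (I i) -> infinite_set (I i') ->
  (form_of S = None -> infinite_set (E i `\` I i) /\ infinite_set (E i' `\` I i')) ->
  separated_translates (ind_group S) A.
Proof.
move=> ii' infI infI' out; pose j b := if b then i else i'.
have inj_j : injective j.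
  by move=> [] [] //= e; move: ii'; rewrite ?e ?eqxx // -e eqxx.
apply: (separated_translates_sub (ind_group_id vS) inj_j).

apply: (separated_pair vS (aE i) (@infE i) (A := fun b => A (j b))) => [b|n b].
  exact: sA.
by case: b => /=; apply: frame_split => //; try exact: isoI; move=> /out[].
Qed.

Lemma separated_small : (forall w, form_of S = Some w -> swap_sign S = -1) ->
  (exists i, finite_set (I i)) -> separated_translates (ind_group S) A.
Proof.
move=> alt /smallest_finite[p [s [us Is min]]].
case ss : (size s) => [|m].
  by have [e] := inI p; rewrite Is (size0nil ss).
have [j [inj_j jp]] := injection_through (@Ordinal 4 0 isT) p hl.
have /choice[t tP] := uniq_seq_of_size us Is min.
have /choice[X /choice[Phi XP]] : forall i, exists X Phi,
    [/\ @frame K V S m.+1 X Phi, forall k, A i (X (k, true)),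
      forall v, A i v -> Phi (ord0, false) v = 0
    & i = p -> forall v, A i v -> v = \sum_k Phi (k, true) v *: X (k, true)].
  move=> i; have [ut tI st tp] := tP i; have [f Ef nIf] := outI i.
  have [|X [Phi [fX XA PhiA sp]]] :=
    frame_small vS (aE i) (@infE i) (@IE i) (@isoI i) ut tI (m := m) _ Ef nIf.
    by rewrite st.
  by exists X, Phi; split=> // /tp.
apply: (separated_translates_sub (ind_group_id vS) inj_j).
apply: (separated_lines vS (aE p) (@infE p) charK (A := fun c => A (j c))
  (X := fun c => X (j c)) (Phi := fun c => Phi (j c))) => //=.
- by move=> i; have [] := XP (j i).
- by move=> i; have [] := XP (j i).
- by move=> i; have [] := XP (j i).
- left; split; last by have [] := XP (j (@Ordinal 4 1 isT)).
  by have [_ _ _] := XP (j (@Ordinal 4 0 isT)); apply.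
Qed.

Lemma separated_cosmall : form_of S = None ->
  (exists i, finite_set (E i `\` I i)) -> separated_translates (ind_group S) A.
Proof.
move=> fS /smallest_finite[p [s [us Is min]]].
case ss : (size s) => [|m].
  have [f Ef nIf] := outI p.
  by have : (E p `\` I p) f by []; rewrite Is (size0nil ss).
have [j [inj_j jp]] := injection_through (@Ordinal 4 1 isT) p hl.
have /choice[t tP] := uniq_seq_of_size us Is min.
have /choice[X /choice[Phi XP]] : forall i, exists X Phi,
    [/\ @frame K V S m.+1 X Phi, A i (X (ord0, true)),
      forall k v, A i v -> Phi (k, false) v = 0
    & i = p -> forall v, (forall k, Phi (k, false) v = 0) -> A i v].
  move=> i; have [ut tI st tp] := tP i; have [e Ie] := inI i.
  have [||X [Phi [fX XA PhiA sp]]] :=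
    frame_cosmall vS (aE i) (@infE i) (@IE i) (s := t i) (m := m) fS ut _ _ Ie.
  - by move=> x /tI.
  - by rewrite st.
  by exists X, Phi; split=> // /tp.
apply: (separated_translates_sub (ind_group_id vS) inj_j).
apply: (separated_lines vS (aE p) (@infE p) charK (A := fun c => A (j c))
  (X := fun c => X (j c)) (Phi := fun c => Phi (j c))) => //=.
- by move=> i; have [] := XP (j i).
- by move=> i; have [] := XP (j i).
- by rewrite fS.
- by move=> i; have [_ _ PhiA _] := XP (j i); apply: PhiA.
- right; split; first by have [] := XP (j (@Ordinal 4 0 isT)).
  by have [_ _ _] := XP (j (@Ordinal 4 1 isT)); apply.
Qed.

Lemma separated_isotropic w p : form_of S = Some w -> swap_sign S = 1 ->
  (forall i, i != p -> finite_set (I i)) -> separated_translates (ind_group S) A.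
Proof.
move=> fS sym fin.
have /choice[s sP] : forall i, exists s : seq V,
    finite_set (I i) -> uniq s /\ I i = [set` s].
  move=> i; have [/finite_uniq_seq[s sP]|nf] := pselect (finite_set (I i)).
    by exists s.
  by exists [::].
(* The bound on dimensions has to leave room for one more pair, since the
   sum of its vectors spans with the first pair the space of the conic. *)
pose m := \max_i size (s i).
have sm i : (size (s i) <= m)%N by apply: leq_bigmax.
have s0 i : finite_set (I i) -> (0 < size (s i))%N.
  move=> /sP[_ Is]; have [e] := inI i.
  by rewrite Is; case: (s i).
have [j [inj_j jp]] := injection_through (@Ordinal 4 0 isT) p hl.
have jfin r : r != @Ordinal 4 0 isT -> finite_set (I (j r)).
  by move=> r0; apply: fin; rewrite -jp; apply: contra_neq r0; apply: inj_j.
have m0 : (0 < m)%N.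
  by apply: leq_trans (sm (j (@Ordinal 4 1 isT))); apply: s0; apply: jfin.
have /choice[X /choice[Phi XP]] : forall i, exists X Phi,
    [/\ @frame K V S m.+1 X Phi, A i (X (ord0, true)),
      forall k v, A i v -> Phi (k, false) v = 0
    & finite_set (I i) -> forall v, A i v ->
        v = \sum_(k < m.+1 | (k < m)%N) Phi (k, true) v *: X (k, true)].
  move=> i; have [fI|infI] := pselect (finite_set (I i)).
    have [us Is] := sP i fI.
    have [X [Phi [fX XA PhiA sp]]] := frame_isotropic vS (aE i) (@infE i) (@IE i)
      (@isoI i) fS us Is (leqW (sm i)).
    exists X, Phi; split=> // [|_ v]; first by apply: XA; apply: s0.
    exact: sp.
  have [|X [Phi [fX XA]]] := frame_split vS (aE i) (@IE i) (@isoI i) m.+1 infI.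
    by rewrite fS.
  exists X, Phi; split=> // [|k v]; first by have [] := XA ord0.
  by have [_] := XA k; apply.
apply: (separated_translates_sub (ind_group_id vS) inj_j).
apply: (separated_conic vS (aE p) (@infE p) charK (A := fun c => A (j c))
  (X := fun c => X (j c)) (Phi := fun c => Phi (j c)) _ _ fS sym m0) => //=.
- by move=> i; have [] := XP (j i).
- by move=> i; have [] := XP (j i).
- by have [_ _ PhiA _] := XP (j (@Ordinal 4 0 isT)); apply: PhiA.
- by move=> i v i0 Av; have [_ _ _ sp] := XP (j i); apply: sp => //; apply: jfin.
Qed.

Lemma separated_configuration : separated_translates (ind_group S) A.
Proof.
pose o0 := Ordinal (leq_trans (isT : 0 < 4)%N hl).
pose o1 := Ordinal (leq_trans (isT : 1 < 4)%N hl).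
have o01 : o0 != o1 by [].
have [[i fI]|nf] := pselect (exists i, finite_set (I i)); last first.
  have infI i : infinite_set (I i) by move=> fI; apply: nf; exists i.
  have [[i fEI]|nfE] := pselect (form_of S = None /\ exists i, finite_set (E i `\` I i)).
    exact: separated_cosmall.
  apply: (separated_two o01) => // fS.
  by split=> fEI; apply: nfE; split=> //; [exists o0 | exists o1].
case fS : (form_of S) => [w|]; last first.
  by apply: separated_small; [rewrite fS | exists i].
have [sg|sg] : swap_sign S = 1 \/ swap_sign S = -1.
- by case: (S) => *; [left | left | right].
- have [[q [q' [qq' iq iq']]]|two] := pselect (exists q q',
      [/\ q != q', infinite_set (I q) & infinite_set (I q')]).
    by apply: (separated_two qq') => //; rewrite fS.
  have [[q iq]|none] := pselect (exists q, infinite_set (I q)).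
    apply: (separated_isotropic (p := q) fS sg) => i' iq'.
    by apply: contrapT => inf; apply: two; exists i', q.
  apply: (separated_isotropic (p := i) fS sg) => i' _.
  by apply: contrapT => inf; apply: none; exists i'.
- by apply: separated_small => //; exists i.
Qed.

End Configuration.

Theorem theorem1p7 (R : realType) (V : lmodType R[i])
    (hV : exists E : set V, is_basis [set: V] E /\ (E #= [set: nat])%card)
    (S : ind_data V) (hS : valid_data S)
    (l : nat) (hl : (4 <= l)%N)
    (P : 'I_l -> set (V -> V))
    (hP : forall i, splitting_parabolic S (P i))
    (hproper : forall i, P i `<` ind_group S) :
  infinite_set (diag_orbits (ind_group S) P).
Proof.
have [E0 [[iE0 _] cE0]] := hV.
have infE0 : infinite_set E0.
  by move=> fE0; apply: infinite_nat; rewrite -(eq_finite_set cE0).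
have charK : injective (fun n => n%:R : R[i]).
  by move=> a b /eqP; rewrite Num.Theory.eqr_nat => /eqP.
have /choice[E /choice[I EI]] := fun i => (parabolic_subspace hS (hP i) (hproper i)).2.
apply: (diag_orbits_infinite (A := fun i => lspan (I i))).
- exact: ind_group_id.
- by move=> i; have [] := parabolic_subspace hS (hP i) (hproper i).
- by move=> i; have [_ _ _ _] := EI i.
have aE i : admissible S (E i) by have [] := EI i.
have infE i : infinite_set (E i).
  by have [[_ sE] _] := aE i; apply: basis_infinite iE0 infE0 sE.
apply: (separated_configuration hS charK hl aE infE) => i.
- by have [] := EI i.
- by have [_ _ []] := EI i.
- by have [_ _ []] := EI i.
- by have [_ _ _ iso _] := EI i; apply: iso.
Qed.
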